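(* Let $1\leq p<2$. Let $\gamma,\tilde{\gamma}:[0,1]\to\mathbb{R}^2$ be simple curves with finite $p$-variation. Then $S(\gamma)_{0,1}=S(\tilde{\gamma})_{0,1}$ if and only if $\gamma$ and $\tilde{\gamma}$ are equal up to a translation and a reparametrisation, i.e. there exist $c\in\mathbb{R}^2$ and a continuous strictly increasing bijection $r:[0,1]\to[0,1]$ such that $\tilde\gamma_t=\gamma_{r(t)}+c$ for all $t\in[0,1]$.
   Context: A simple curve is a continuous injective map $\gamma:[0,1]\to\mathbb{R}^2$. A continuous $\gamma:[0,1]\to\mathbb{R}^2$ has finite $p$-variation if $\sup\sum_k|\gamma_{t_{k+1}}-\gamma_{t_k}|^p<\infty$, the supremum being over all finite partitions of $[0,1]$. For such $\gamma$ with $1\le p<2$, the signature is $S(\gamma)_{0,1}=1+\sum_{n\ge1}\int_{0<t_1<\cdots<t_n<1}\mathrm{d}\gamma_{t_1}\otimes\cdots\otimes\mathrm{d}\gamma_{t_n}$ (Young integrals), an element of the space $T((\mathbb{R}^2))$ of sequences $(a_0,a_1,\ldots)$ with $a_i\in(\mathbb{R}^2)^{\otimes i}$. *)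

(* Defs.v *)
From HB Require Import structures.
From mathcomp Require Import all_boot all_order all_algebra.
From mathcomp Require Import all_classical all_reals all_analysis.

Set Implicit Arguments.
Unset Strict Implicit.
Unset Printing Implicit Defensive.

Import Order.TTheory GRing.Theory Num.Theory.
Import numFieldNormedType.Exports.

Local Open Scope classical_set_scope.
Local Open Scope ring_scope.

(* A path in R^d parametrised by [a, b] is a function R -> 'rV[R]_d of which
   only the values on [a, b] matter. As in itv_partition, a partition
   a = x_0 < x_1 < ... < x_n = b is the sequence s = [:: x_1; ...; x_n], and
   x_k = nth b (a :: s) k. *)

(* The library norm on 'rV[R]_d is the sup norm. *)
Definition enorm (R : realType) (d : nat) (v : 'rV[R]_d) : R :=
  Num.sqrt (\sum_(i < d) v 0 i ^+ 2).

Definition simple_curve (R : realType) (d : nat) (gamma : R -> 'rV[R]_d) :=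
  {within `[0, 1], continuous gamma} /\ set_inj `[0, 1] gamma.

Definition pvar_sum (R : realType) (d : nat) (p a b : R)
    (gamma : R -> 'rV[R]_d) (s : seq R) : R :=
  let x := nth b (a :: s) in
  \sum_(0 <= k < size s) enorm (gamma (x k.+1) - gamma (x k)) `^ p.

Definition finite_pvariation (R : realType) (d : nat) (p a b : R)
    (gamma : R -> 'rV[R]_d) : Prop :=
  (ereal_sup [set (pvar_sum p a b gamma s)%:E | s in itv_partition a b]
     < +oo)%E.

(* The second component of a tagged partition gives the tags: the k-th one lies
   in [x_k, x_{k+1}] for k < n, its values for k >= n are irrelevant. *)
Definition tagged_partition (R : realType) (a b : R) (P : seq R * (nat -> R)) :=
  itv_partition a b P.1 /\
  forall k, (k < size P.1)%N ->
    nth b (a :: P.1) k <= P.2 k <= nth b (a :: P.1) k.+1.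

Definition finer (R : realType) (a b delta : R) (P : seq R * (nat -> R)) :=
  forall k, (k < size P.1)%N ->
    nth b (a :: P.1) k.+1 - nth b (a :: P.1) k < delta.

(* "mesh tends to 0" *)
Definition mesh_filter (R : realType) (a b : R) :
    set_system (seq R * (nat -> R)) :=
  filter_from [set delta : R | 0 < delta]
    (fun delta => [set P | tagged_partition a b P /\ finer a b delta P]).

Definition riemann_stieltjes_sum (R : realType) (f g : R -> R) (a b : R)
    (P : seq R * (nat -> R)) : R :=
  let x := nth b (a :: P.1) in
  \sum_(0 <= k < size P.1) f (P.2 k) * (g (x k.+1) - g (x k)).

(* The Young integral of f against g over [a, b]; an unspecified value when the
   limit does not exist. *)
Definition young_integral (R : realType) (f g : R -> R) (a b : R) : R :=
  lim (riemann_stieltjes_sum f g a b @ mesh_filter a b).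

(* For w = (i_1, ..., i_n), the value at t of
     int_{a < t_1 < ... < t_n < t} dgamma^{i_1}_{t_1} ... dgamma^{i_n}_{t_n};
   the first letter i_1 is the innermost integral. *)
Definition iterated_integral (R : realType) (d : nat) (gamma : R -> 'rV[R]_d)
    (a : R) (w : seq 'I_d) : R -> R :=
  foldl (fun (F : R -> R) (i : 'I_d) (t : R) =>
           young_integral F (fun u => gamma u 0 i) a t)
        (fun=> 1) w.

(* (R^d)^{\otimes n} in the coordinates given by the basis
   e_{i_1} \otimes ... \otimes e_{i_n}. *)
Definition tensor (R : realType) (d n : nat) := {ffun n.-tuple 'I_d -> R}.

(* T((R^d)) *)
Definition tensor_series (R : realType) (d : nat) := forall n, tensor R d n.

Definition signature (R : realType) (d : nat) (gamma : R -> 'rV[R]_d)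
    (a b : R) : tensor_series R d :=
  fun n => [ffun w : n.-tuple 'I_d => iterated_integral gamma a w b].

Definition increasing_reparametrisation (R : realType) (r : R -> R) :=
  [/\ {within `[0, 1], continuous r},
      {in `[0, 1]%R &, {homo r : s t / s < t}} &
      set_bij `[0, 1] `[0, 1] r].

Lemma mesh_filter_filter (R : realType) (a b : R) : Filter (mesh_filter a b).
Proof.
apply: filter_from_filter; first by exists 1 => /=.
move=> e1 e2 /= e10 e20; exists (Num.min e1 e2) => /=.
  by rewrite lt_min e10.
move=> P /= [tP fP]; split; split=> // k kP.
  by have := fP k kP; rewrite lt_min => /andP[].
by have := fP k kP; rewrite lt_min => /andP[].
Qed.

Lemma mesh_filter_proper (R : realType) (a b : R) : a <= b ->
  ProperFilter (mesh_filter a b).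
Proof.
move=> ab; apply: filter_from_proper; first exact: mesh_filter_filter.
move=> e /= e0; pose n := (Num.truncn ((b - a) / e)).+1.
move: ab; rewrite le_eqVlt => /predU1P[<-|ab].
  by exists ([::], fun=> 0); split.
have n0 : 0 < n%:R :> R by rewrite ltr0n.
pose h := (b - a) / n%:R; pose x k : R := a + k%:R * h.
have h0 : 0 < h by rewrite divr_gt0 ?subr_gt0.
have he : h < e.
  by rewrite ltr_pdivrMr// mulrC -ltr_pdivrMr// truncnS_gt.
have xlt k l : (k < l)%N -> x k < x l.
  by move=> kl; rewrite ltrD2l ltr_pM2r// ltr_nat.
have xS k : x k.+1 - x k = h.
  by apply/eqP; rewrite subr_eq /x -natr1 mulrDl mul1r addrA addrC.
have x0 : x 0%N = a by rewrite /x mul0r addr0.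
have xn : x n = b by rewrite /x mulrC divfK ?gt_eqF// addrC subrK.
have E k : (k <= n)%N -> nth b (a :: [seq x i | i <- iota 1 n]) k = x k.
  case: k => [_|k kn]; first by rewrite x0.
  by rewrite -[LHS]/(nth b (map x (iota 1 n)) k)
    (nth_map 0%N) ?size_iota// nth_iota.
have S : size [seq x i | i <- iota 1 n] = n by rewrite size_map size_iota.
exists ([seq x i | i <- iota 1 n], x); split; first split; first split.
- rewrite -x0 path_map; apply: (@sub_path _ ltn) => [k l|]; first exact: xlt.
  exact: (iota_ltn_sorted 0 n.+1).
- by rewrite (last_nth b) S E// xn.
- by move=> k; rewrite S => kn; rewrite !E ?(ltnW kn)// lexx ltW ?xlt.
- by move=> k; rewrite S => kn; rewrite !E ?(ltnW kn)// xS.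
Qed.

(* Main.v *)
Require Import Defs.
From mathcomp Require Import all_boot all_order all_algebra.
From mathcomp Require Import all_classical all_reals all_analysis.
From mathcomp Require Import ring lra zify.
Import Order.TTheory GRing.Theory Num.Theory.
Import numFieldNormedType.Exports.

Local Open Scope classical_set_scope.
Local Open Scope ring_scope.

(* Write gamma for a simple curve with finite p-variation, and choose q with
   p < q < 2. The q-variation of gamma over subintervals is a superadditive
   control that vanishes on short intervals, so Young integrals against the
   coordinates of gamma exist, and an indefinite integral of F against g is
   characterised, up to a constant, by its increments being F_s (g_t - g_s) up
   to O(w(s, t)^(2/q)). This characterisation gives the chain rule and the
   invariance of the signature under reparametrisation.

   Conversely, by the chain rule the monomials in the coordinates of
   gamma - gamma_0 are linear combinations of iterated integrals, so the
   signature determines the integrals of polynomial one-forms. Bernstein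
   polynomials converge uniformly without increasing Lipschitz constants, hence
   the signature determines the integrals of one-forms phi dx_i with phi
   Lipschitz. Suppose gamma_u - gamma_0 is not on gamma' - gamma'_0. Then some
   arc gamma([s, t]) with gamma_s <> gamma_t in the i-th coordinate avoids it as
   well. Take phi = chi h'(x_i) where chi is a cutoff, equal to 1 on that arc and
   to 0 on the rest of gamma (except for short pieces next to the arc, where h' = 0)
   and on gamma', and where h increases from 0 near gamma_s to 1 near gamma_t.
   The integral of phi dx_i is h(gamma_t) - h(gamma_s) = 1 along gamma and 0 along
   gamma', so the signatures differ. Two simple curves with the same trace
   and the same starting point differ by an increasing homeomorphism. *)

Set Implicit Arguments.
Unset Strict Implicit.
Unset Printing Implicit Defensive.

(** * Superadditive controls and the sewing bound *)

Section ChainSum.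
Variable R : realType.
Implicit Types (X Y : R -> R -> R) (a b d : R) (s t : seq R).

(** Recursion on the list makes partition sums easy to split and compare; [chain_sumE] translates
    the indexed sums of the definitions into this form. *)
Fixpoint chain_sum X a s : R :=
  if s is x :: s' then X a x + chain_sum X x s' else 0.

(** As the relation of a [path], it records strict increase and mesh below [d] at once. *)
Definition mesh_lt d : rel R := [rel u v | (u < v) && (v - u < d)].

Lemma chain_sumE X a b s :
  \sum_(0 <= k < size s) X (nth b (a :: s) k) (nth b (a :: s) k.+1)
  = chain_sum X a s.
Proof.
elim: s a => [|x s IH] a; first by rewrite big_nil.
by rewrite big_nat_recl//= -IH.
Qed.

Lemma chain_sum_cat X a s t :
  chain_sum X a (s ++ t) = chain_sum X a s + chain_sum X (last a s) t.
Proof. by elim: s a => [|x s IH] a /=; rewrite ?add0r// IH addrA. Qed.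

Lemma chain_sum_telescope (f : R -> R) a s :
  chain_sum (fun u v => f v - f u) a s = f (last a s) - f a.
Proof. by elim: s a => [|x s IH] a /=; rewrite ?subrr// IH; ring. Qed.

Lemma chain_sumB X Y a s :
  chain_sum (fun u v => X u v - Y u v) a s = chain_sum X a s - chain_sum Y a s.
Proof. by elim: s a => [|x s IH] a /=; rewrite ?subr0// IH; ring. Qed.

Lemma chain_sumZ k X a s :
  chain_sum (fun u v => k * X u v) a s = k * chain_sum X a s.
Proof. by elim: s a => [|x s IH] a /=; rewrite ?mulr0// IH; ring. Qed.

Lemma ler_norm_chain_sum X a s :
  `|chain_sum X a s| <= chain_sum (fun u v => `|X u v|) a s.
Proof.
elim: s a => [|x s IH] a /=; first by rewrite normr0.
by rewrite (le_trans (ler_normD _ _))// lerD2l.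
Qed.

Lemma path_le_last a s : path <%R a s -> a <= last a s.
Proof.
by move=> p; apply: (@itv_partition_le _ _ a (last a s) s); split.
Qed.

Lemma mesh_ltW d : subrel (mesh_lt d) <%R.
Proof. by move=> u v /andP[]. Qed.

Lemma path_mesh_lt d a s : path (mesh_lt d) a s -> path <%R a s.
Proof. exact/sub_path/mesh_ltW. Qed.

Lemma ler_chain_sum (e : rel R) X Y a s : subrel e <%R ->
  (forall u v, e u v -> 0 <= u -> v <= 1 -> X u v <= Y u v) ->
  path e a s -> 0 <= a -> last a s <= 1 -> chain_sum X a s <= chain_sum Y a s.
Proof.
move=> elt XY; elim: s a => [//|x s IH] a /= /andP[ax p] a0 s1.
have ltax := elt _ _ ax.
have x1 : x <= 1.
  by rewrite (le_trans _ s1)// path_le_last// (sub_path elt).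
by rewrite lerD ?XY// IH// (le_trans a0)// ltW.
Qed.

Lemma chain_sum_ge0 X a s : (forall u v, 0 <= X u v) -> 0 <= chain_sum X a s.
Proof.
by move=> X0; elim: s a => [//|x s IH] a /=; rewrite addr_ge0.
Qed.

End ChainSum.

Section Control.
Variable R : realType.
Implicit Types (w F g H : R -> R -> R).

(** Continuity is asked only at the diagonal, uniformly: short intervals have small control. *)
Definition control (w : R -> R -> R) :=
  [/\ forall s t, 0 <= s -> s <= t -> t <= 1 -> 0 <= w s t,
      forall s u t, 0 <= s -> s <= u -> u <= t -> t <= 1 ->
        w s u + w u t <= w s t &
      forall e, 0 < e -> exists2 d, 0 < d &
        forall s t, 0 <= s -> s <= t -> t <= 1 -> t - s < d -> w s t < e].

(** With [al] = 1/q, this says that the q-th powers of the increments are dominated by a multiple of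
    [w], so that F has finite q-variation. *)
Definition holder w (al A : R) (F : R -> R) :=
  0 <= A /\ forall s t, 0 <= s -> s <= t -> t <= 1 ->
    `|F t - F s| <= A * w s t `^ al.

Variables (w : R -> R -> R) (cw : control w).

Lemma control_ge0 s t : 0 <= s -> s <= t -> t <= 1 -> 0 <= w s t.
Proof. by case: cw => w0 _ _; exact: w0. Qed.

Lemma control_add s u t : 0 <= s -> s <= u -> u <= t -> t <= 1 ->
  w s u + w u t <= w s t.
Proof. by case: cw => _ wD _; exact: wD. Qed.

Lemma control_le s u v t : 0 <= s -> s <= u -> u <= v -> v <= t -> t <= 1 ->
  w u v <= w s t.
Proof.
move=> s0 su uv vt t1.
have su0 := control_ge0 s0 su (le_trans uv (le_trans vt t1)).
have vt0 := control_ge0 (le_trans s0 (le_trans su uv)) vt t1.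
have h1 := control_add s0 su (le_trans uv vt) t1.
have h2 := control_add (le_trans s0 su) uv vt t1.
lra.
Qed.

Lemma control_xx s : 0 <= s -> s <= 1 -> w s s = 0.
Proof.
move=> s0 s1; apply/eqP; rewrite eq_le control_ge0// andbT.
have := control_add s0 (lexx s) (lexx s) s1; lra.
Qed.

Lemma chain_sum_control a s : path <%R a s -> 0 <= a -> last a s <= 1 ->
  chain_sum w a s <= w a (last a s).
Proof.
elim: s a => [|x s IH] a /= => [_ a0 a1|/andP[ax p] a0 s1].
  by rewrite control_ge0.
have xs := path_le_last p.
rewrite (le_trans _ (control_add a0 (ltW ax) xs s1))// lerD2l IH//.
by rewrite (le_trans a0)// ltW.
Qed.

(* x is the first point with w(a, x) > W / 2, or else the last one; then
   w(x, b) <= W / 2 by superadditivity. *)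
Lemma control_halve a s : path <%R a s -> 0 <= a -> last a s <= 1 -> s != [::] ->
  exists s1 x s2, [/\ s = s1 ++ x :: s2,
    w a (last a s1) <= w a (last a s) / 2 & w x (last x s2) <= w a (last a s) / 2].
Proof.
move=> ps a0 s1; set b := last a s; set W := w a b.
have ab : a <= b by exact: path_le_last.
have W0 : 0 <= W by exact: control_ge0.
(* The list is scanned from the left: [y] is the last point passed and [t] is what remains. *)
suff gen : forall y t, path <%R y t -> a <= y -> last y t = b ->
    w a y <= W / 2 -> t != [::] ->
  exists s1 x s2, [/\ t = s1 ++ x :: s2,
    w a (last y s1) <= W / 2 & w x (last x s2) <= W / 2].
  by move=> sN; apply: gen => //; rewrite control_xx//; [lra | exact: le_trans ab s1].
move=> y t; elim: t y => [//|x t IH] y /= /andP[yx pt] ay tb way _.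
have xb : x <= b by rewrite -tb path_le_last.
have ax : a <= x by rewrite (le_trans ay)// ltW.
have [wax|wax] := lerP (w a x) (W / 2); last first.
  exists [::], x, t; split=> //=; rewrite tb.
  by have := control_add a0 ax xb s1; rewrite -/W; lra.
case: t => [|z t] in IH pt tb *.
  exists [::], x, [::]; split => //=; rewrite control_xx//; first by lra.
  - exact: le_trans a0 ax.
  - by rewrite (le_trans xb).
have [s3 [u [s4 [e h1 h2]]]] := IH x pt ax tb wax isT.
by exists (x :: s3), u, s4; split; rewrite // e.
Qed.

(** The fixed point of C = 2 * 2^(-th) C + 2, the recursion produced by one halving step in
    [sewing_bound]. *)
Definition sewing_const (th : R) : R := 2 / (1 - 2 * 2^-1 `^ th).

Lemma half_powR_lt (th : R) : 1 < th -> 0 < 1 - 2 * 2^-1 `^ th :> R.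
Proof.
move=> th1; have th0 : 0 < th by lra.
rewrite subr_gt0 -(mulr_powRB1 _ th0) ?invr_ge0// mulrA divff ?pnatr_eq0// mul1r.
have e1 : 1 `^ (th - 1) = 1 :> R by rewrite powR1.
by rewrite -[ltRHS]e1 gt0_ltr_powR ?nnegrE ?invr_ge0//; lra.
Qed.

Lemma sewing_const_gt0 th : 1 < th -> 0 < sewing_const th.
Proof. by move=> /half_powR_lt h; rewrite divr_gt0. Qed.

Lemma sewing_constE th : 1 < th ->
  sewing_const th * (2 * 2^-1 `^ th) + 2 = sewing_const th.
Proof. by move=> /half_powR_lt h; rewrite /sewing_const; field; lra. Qed.

(** Induction on the number of points. [control_halve] cuts the list at a gap [u, x] whose two sides
    carry at most half of the control W, so each side costs C K (W/2)^th by induction; reattaching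
    the gap uses two defects of at most K W^th. Since th > 1, 2 * 2^(-th) < 1 and the constant
    closes up. *)
Lemma sewing_bound th K X : 1 < th -> 0 <= K ->
  (forall s u t, 0 <= s -> s <= u -> u <= t -> t <= 1 ->
    `|X s t - X s u - X u t| <= K * w s t `^ th) ->
  forall a s, path <%R a s -> 0 <= a -> last a s <= 1 ->
    `|chain_sum X a s - X a (last a s)|
      <= sewing_const th * K * w a (last a s) `^ th.
Proof.
move=> th1 K0 XK a s; have [n] := ubnP (size s).
have th0 : 0 < th by lra.
elim: n s a => [//|n IH] s a sn ps a0 s1.
have a1 : a <= 1 by apply: le_trans s1; exact: path_le_last.
have [->|sN] := eqVneq s [::].
  rewrite /= control_xx// powR0 ?gt_eqF// mulr0.
  (* The defect bound at s = u = t forces X a a = 0. *)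
  have := XK a a a a0 (lexx _) (lexx _) a1.
  rewrite control_xx// powR0 ?gt_eqF// mulr0 => h.
  by rewrite sub0r normrN; move: h; rewrite subrr sub0r normrN.
have [s3 [x [s4 [e h1 h2]]]] := control_halve ps a0 s1 sN.
set b := last a s in h1 h2 s1 *; set u := last a s3 in h1 *.
have eb : last x s4 = b by rewrite /b e last_cat.
rewrite eb in h2.
move: ps; rewrite e cat_path /= -/u => /and3P[p3 ux p4].
rewrite chain_sum_cat /= -/u.
have au : a <= u by exact: path_le_last.
have xb : x <= b by rewrite -eb; exact: path_le_last.
have ab := le_trans (le_trans au (ltW ux)) xb.
have u1 : u <= 1 by lra.
have x0 : 0 <= x by lra.
move: sn; rewrite e size_cat /= ltnS addnS => sn.
have [sn3 sn4] : (size s3 < n)%N /\ (size s4 < n)%N 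
  by split; apply: leq_ltn_trans sn; rewrite ?leq_addr ?leq_addl.
have IH3 := IH s3 a sn3 p3 a0 u1.
have IH4 : `|chain_sum X x s4 - X x b|
    <= sewing_const th * K * w x b `^ th.
  by rewrite -eb; apply: IH; rewrite ?eb.
have t1 := XK a u b a0 au (le_trans (ltW ux) xb) s1.
have t2 := XK u x b (le_trans a0 au) (ltW ux) xb s1.
set W := w a b in h1 h2 t1 *.
have W0 : 0 <= W by rewrite control_ge0.
have mono v : 0 <= v -> v <= W -> v `^ th <= W `^ th.
  by move=> v0 vW; rewrite ge0_ler_powR ?nnegrE//; lra.
have half v : 0 <= v -> v <= W / 2 -> v `^ th <= 2^-1 `^ th * W `^ th.
  by move=> v0 vW; rewrite -powRM ?invr_ge0// ge0_ler_powR ?nnegrE//; lra.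
have c0 : 0 <= sewing_const th * K by rewrite mulr_ge0// ltW// sewing_const_gt0.
have k3 : sewing_const th * K * w a u `^ th
    <= sewing_const th * K * (2^-1 `^ th * W `^ th).
  by rewrite ler_wpM2l// half// control_ge0.
have k4 : sewing_const th * K * w x b `^ th
    <= sewing_const th * K * (2^-1 `^ th * W `^ th).
  by rewrite ler_wpM2l// half// control_ge0.
have k2 : K * w u b `^ th <= K * W `^ th.
  by rewrite ler_wpM2l// mono ?control_ge0 ?control_le//; lra.
rewrite -{1}(sewing_constE th1).
have -> : (sewing_const th * (2 * 2^-1 `^ th) + 2) * K * W `^ th =
  sewing_const th * K * (2^-1 `^ th * W `^ th) * 2 + K * W `^ th * 2 by ring.
have -> : chain_sum X a s3 + (X u x + chain_sum X x s4) - X a b =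
  (chain_sum X a s3 - X a u) + (chain_sum X x s4 - X x b)
  - (X a b - X a u - X u b) - (X u b - X u x - X x b) by ring.
move: IH3 IH4 t1 t2 k3 k4 k2; rewrite -/u !ler_norml.
by move=> /andP[? ?] /andP[? ?] /andP[? ?] /andP[? ?] ? ? ?; apply/andP; split; lra.
Qed.

End Control.

(** * Young integrals *)

Section Refinement.
Variable R : realType.
Implicit Types (a b : R) (s t r : seq R).

Lemma subseq_consP (T : eqType) (x : T) (s r : seq T) : subseq (x :: s) r ->
  exists r1 r2 : seq T, r = r1 ++ x :: r2 /\ subseq s r2.
Proof.
elim: r => [//|y r IH] /=; case: eqP => [<- sr|_ /IH[r1 [r2 [-> sr]]]].
  by exists [::], r.
by exists (y :: r1), r2.
Qed.

Lemma path_mem_le_last a s x : path <%R a s -> x \in a :: s -> x <= last a s.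
Proof.
elim: s a => [|y s IH] a /=; first by rewrite inE => _ /eqP->.
move=> /andP[ay ps]; rewrite inE => /predU1P[->|]; last exact: IH.
by rewrite (le_trans (ltW ay))// path_le_last.
Qed.

(** The refinement is the sorted union without repetitions; a strictly increasing list whose points
    belong to it is the subsequence obtained by filtering. *)
Lemma common_refinement a b s t : itv_partition a b s -> itv_partition a b t ->
  exists r, [/\ itv_partition a b r, subseq s r & subseq t r].
Proof.
move=> [ps /eqP ls] [pt /eqP lt].
pose r := sort <=%R (undup (s ++ t)).
have mr x : (x \in r) = (x \in s) || (x \in t).
  by rewrite mem_sort mem_undup mem_cat.
have sr : sorted <%R r by rewrite sort_lt_sorted undup_uniq.
have pr : path <%R a r.
  rewrite lt_path_sortedE sr andbT; apply/allP => x; rewrite mr => /orP[].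
  - exact/allP/lt_path_min.
  - exact/allP/lt_path_min.
have sub u : path <%R a u -> {subset u <= r} -> subseq u r.
  move=> pu ur; suff -> : u = [seq x <- r | x \in u] by exact: filter_subseq.
  apply: lt_sorted_eq; first exact: path_sorted pu.
    exact: lt_sorted_filter.
  move=> x; rewrite mem_filter; apply/idP/andP => [xu|[]//].
  by split=> //; exact: ur.
have ss : subseq s r by apply: sub => // x xs; rewrite mr xs.
have st : subseq t r by apply: sub => // x xt; rewrite mr xt orbT.
exists r; split=> //; split=> //; apply/eqP/le_anti/andP; split.
  have := mem_last a r; rewrite inE => /predU1P[->|].
    by rewrite -ls path_le_last.
  rewrite mr => /orP[h|h].
    by rewrite -[leRHS]ls path_mem_le_last// inE h orbT.
  by rewrite -[leRHS]lt path_mem_le_last// inE h orbT.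
apply: path_mem_le_last => //; rewrite -ls; have := mem_last a s.
by rewrite !inE => /predU1P[->|h]; rewrite ?eqxx// mr h orbT.
Qed.

Lemma finer_path d a b (P : seq R * (nat -> R)) :
  tagged_partition a b P -> finer a b d P -> path (mesh_lt d) a P.1.
Proof.
move=> [[pP _] _] fP; apply/(pathP b) => i iP; rewrite /mesh_lt /=.
by have /(pathP b)/(_ i iP) -> := pP; exact: fP.
Qed.

Lemma fine_partition a b d : a <= b -> 0 < d ->
  exists2 s, itv_partition a b s & path (mesh_lt d) a s.
Proof.
move=> ab d0; have FF := mesh_filter_proper ab.
have : mesh_filter a b [set P | tagged_partition a b P /\ finer a b d P].
  by exists d.
by move=> /filter_ex[P [tP fP]]; exists P.1; [case: tP|exact: finer_path fP].
Qed.

Lemma eq_of_dist_le (x y : R) : (forall e, 0 < e -> `|x - y| <= e) -> x = y.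
Proof.
move=> h; apply/eqP; rewrite -subr_eq0 -normr_le0.
by apply/ler_addgt0Pr => e e0; rewrite add0r h.
Qed.

End Refinement.

(** * Existence and characterisation of the Young integral *)

Section Young.
Variables (R : realType) (w : R -> R -> R) (cw : control w) (al : R).
Hypothesis al2 : 1 < al + al.
Implicit Types (F g H : R -> R) (a b s t : R).

Definition left_sum F g := chain_sum (fun u v => F u * (g v - g u)).

Let C := sewing_const (al + al).
Let th0 : al + al != 0. Proof. by rewrite gt_eqF//; have := al2; lra. Qed.
Let al0 : 0 <= al. Proof. by have := al2; lra. Qed.
Let C0 : 0 <= C. Proof. exact/ltW/sewing_const_gt0. Qed.

Lemma holder_le A F s u v t : holder w al A F ->
  0 <= s -> s <= u -> u <= v -> v <= t -> t <= 1 ->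
  `|F v - F u| <= A * w s t `^ al.
Proof.
move=> [A0 hF] s0 su uv vt t1.
rewrite (le_trans (hF u v _ uv _)) ?(le_trans s0) ?(le_trans vt)//.
by rewrite ler_wpM2l// ge0_ler_powR ?nnegrE ?(control_ge0 cw) ?(control_le cw)//; lra.
Qed.

Lemma holder_mul_le A B F g s u v u' v' t : holder w al A F -> holder w al B g ->
  0 <= s -> s <= u -> u <= v -> v <= t -> s <= u' -> u' <= v' -> v' <= t ->
  t <= 1 ->
  `|(F v - F u) * (g v' - g u')| <= A * B * w s t `^ (al + al).
Proof.
move=> hF hg s0 su uv vt su' uv' vt' t1.
rewrite powRD ?(negbTE th0)// normrM mulrACA.
by rewrite ler_pM// ?(holder_le hF) ?(holder_le hg).
Qed.

(** The Young-Loeve estimate: F_s (g_t - g_s) has defect -(F_u - F_s)(g_t - g_u), of order w^(2 al)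
    with 2 al > 1, so the sewing bound applies. *)
Lemma left_sum_bound A B F g a r : holder w al A F -> holder w al B g ->
  path <%R a r -> 0 <= a -> last a r <= 1 ->
  `|left_sum F g a r - F a * (g (last a r) - g a)|
    <= C * (A * B) * w a (last a r) `^ (al + al).
Proof.
move=> hF hg.
apply: (sewing_bound cw (X := fun u v => F u * (g v - g u))) => //.
  by rewrite mulr_ge0 ?(proj1 hF) ?(proj1 hg).
move=> s u t s0 su ut t1.
have -> : F s * (g t - g s) - F s * (g u - g s) - F u * (g t - g u) =
  - ((F u - F s) * (g t - g u)) by ring.
by rewrite normrN (holder_mul_le hF hg).
Qed.

(** [left_sum_bound] on each interval of the coarser partition [s], with the errors added up. *)
Lemma refine_bound A B F g a (s r : seq R) : holder w al A F -> holder w al B g ->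
  path <%R a r -> 0 <= a -> last a r <= 1 -> subseq s r -> last a s = last a r ->
  `|left_sum F g a r - left_sum F g a s|
    <= C * (A * B) * chain_sum (fun u v => w u v `^ (al + al)) a s.
Proof.
move=> hF hg; elim: s a r => [|x s IH] a r pr a0 r1 sr ls.
  have -> : r = [::] by apply: (@itv_partitionxx _ _ a); split=> //; rewrite -ls.
  by rewrite /= subrr normr0 mulr0.
have [r1' [r2 [e sr2]]] := subseq_consP sr; move: e; rewrite -cat_rcons.
set r3 := rcons r1' x => e; rewrite {}e in pr r1 ls *.
have lr3 : last a r3 = x by rewrite last_rcons.
move: pr ls r1; rewrite cat_path last_cat lr3 /= => /andP[p3 p2] ls r1.
have ax : a <= x by rewrite -lr3 path_le_last.
have x1 : x <= 1 by rewrite (le_trans _ r1)// path_le_last.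
rewrite [left_sum _ _ a (r3 ++ _)]chain_sum_cat lr3 -!/(left_sum _ _ _ _).
have -> : left_sum F g a r3 + left_sum F g x r2
   - (F a * (g x - g a) + left_sum F g x s) =
  (left_sum F g a r3 - F a * (g x - g a))
    + (left_sum F g x r2 - left_sum F g x s) by ring.
rewrite (le_trans (ler_normD _ _))//= [leRHS]mulrDr lerD//.
  by have := left_sum_bound hF hg p3 a0; rewrite lr3; apply.
by rewrite IH// (le_trans a0).
Qed.

(** Write w^(2 al) as w^(2 al - 1) w: the first factor is uniformly small on short intervals, and
    the second sums to at most w(0, 1) by superadditivity. *)
Lemma control_pow_small e : 0 < e -> exists2 d, 0 < d &
  forall a r, path (mesh_lt d) a r -> 0 <= a -> last a r <= 1 ->
    chain_sum (fun u v => w u v `^ (al + al)) a r <= e.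
Proof.
move=> e0; set W := w 0 1; have W0 : 0 <= W by rewrite (control_ge0 cw).
have a2 := al2; have th1 : al + al - 1 != 0 by rewrite gt_eqF//; lra.
(* [eta] is chosen so that w < eta gives w^(2 al - 1) <= k, while k W <= e. *)
pose k := e / (W + 1); have k0 : 0 < k by rewrite divr_gt0//; lra.
pose eta := k `^ (al + al - 1)^-1; have eta0 : 0 < eta by rewrite powR_gt0.
have [_ _ /(_ _ eta0)[d d0 hd]] := cw; exists d => // a r pr a0 r1.
have p := path_mesh_lt pr.
apply: (@le_trans _ _ (k * chain_sum w a r)); last first.
  apply: (@le_trans _ _ (k * W)); last first.
    by rewrite /k mulrAC ler_pdivrMr ?ler_wpM2l//; lra.
  rewrite ler_wpM2l ?(ltW k0)// (le_trans (chain_sum_control cw p a0 r1))//.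
  by rewrite (control_le cw)// path_le_last.
rewrite -chain_sumZ; apply: ler_chain_sum pr a0 r1; first exact: mesh_ltW.
move=> u v /andP[/= uv vd] u0 v1; have w0 := control_ge0 cw u0 (ltW uv) v1.
rewrite -mulr_powRB1//; last by lra.
rewrite mulrC ler_wpM2r// -[leRHS]powRr1 ?(ltW k0)//.
rewrite -[X in k `^ X](mulVf th1) powRrM ge0_ler_powR ?nnegrE ?powR_ge0//; first by lra.
exact: ltW (hd u v u0 (ltW uv) v1 vd).
Qed.

(** Both sums are compared with the sum over a common refinement. The mesh is fixed before F and g
    and depends only on their Hölder constants; [young_close] relies on this uniformity. *)
Lemma left_sum_cauchy A B e : 0 <= A -> 0 <= B -> 0 < e ->
  exists2 d, 0 < d & forall F g a b (r s : seq R), holder w al A F -> holder w al B g ->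
    0 <= a -> b <= 1 -> itv_partition a b r -> itv_partition a b s ->
    path (mesh_lt d) a r -> path (mesh_lt d) a s ->
    `|left_sum F g a r - left_sum F g a s| <= e.
Proof.
move=> A0 B0 e0; set K := C * (A * B).
have K0 : 0 <= K by apply: mulr_ge0 => //; exact: mulr_ge0.
have [|d d0 hd] := @control_pow_small (e / (2 * K + 1)).
  by rewrite divr_gt0//; lra.
exists d => // F g a b r s hF hg a0 b1 ir is_ fr fs.
have [t [it rt st]] := common_refinement ir is_.
move: ir is_ it => [pr /eqP lr] [ps /eqP ls] [pt /eqP lt].
have h1 := refine_bound hF hg pt a0.
have hr := h1 _ _ rt _; rewrite lt lr in hr; have {}hr := hr b1 erefl.
have hs := h1 _ _ st _; rewrite lt ls in hs; have {}hs := hs b1 erefl.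
have {hr}hr : `|left_sum F g a t - left_sum F g a r| <= K * (e / (2 * K + 1)).
  by rewrite (le_trans hr)// ler_wpM2l// hd// lr.
have {hs}hs : `|left_sum F g a t - left_sum F g a s| <= K * (e / (2 * K + 1)).
  by rewrite (le_trans hs)// ler_wpM2l// hd// ls.
have -> : left_sum F g a r - left_sum F g a s =
  - (left_sum F g a t - left_sum F g a r)
  + (left_sum F g a t - left_sum F g a s) by ring.
rewrite (le_trans (ler_normD _ _))// normrN (le_trans (lerD hr hs))//.
rewrite -mulr2n -mulrnAl mulrA ler_pdivrMr; last by lra.
rewrite mulrC ler_wpM2l ?(ltW e0)// -mulr_natl; lra.
Qed.

(** Moving a tag to the left endpoint costs a product of an increment of F and one of g over the
    same interval, of order w^(2 al). *)
Lemma tagged_sum_bound A B F g a b P : holder w al A F -> holder w al B g ->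
  0 <= a -> b <= 1 -> tagged_partition a b P ->
  `|riemann_stieltjes_sum F g a b P - left_sum F g a P.1|
    <= A * B * chain_sum (fun u v => w u v `^ (al + al)) a P.1.
Proof.
move=> hF hg a0 b1 [iP tP]; rewrite /left_sum -!(chain_sumE _ a b).
rewrite /riemann_stieltjes_sum -sumrB mulr_sumr.
rewrite (le_trans (ler_norm_sum _ _ _))// ler_sum_nat// => k /= kP.
have /andP[t1 t2] := tP k kP.
have x0 : 0 <= nth b (a :: P.1) k.
  by rewrite (le_trans a0)// (itv_partition_nth_ge _ iP)// ltnW.
have x1 : nth b (a :: P.1) k.+1 <= 1.
  by rewrite (le_trans _ b1)// (itv_partition_nth_le _ iP).
by rewrite -mulrBl (holder_mul_le hF hg)// (le_trans t1).
Qed.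

Lemma young_cvg A B F g a b : holder w al A F -> holder w al B g ->
  0 <= a -> a <= b -> b <= 1 -> cvg (riemann_stieltjes_sum F g a b @ mesh_filter a b).
Proof.
move=> hF hg a0 ab b1; have FF := mesh_filter_proper ab.
apply/cauchy_cvgP/cauchy_exP => e e0.
have A0 := proj1 hF; have B0 := proj1 hg.
have AB0 : 0 <= A * B by exact: mulr_ge0.
have [|d1 d10 h1] := @left_sum_cauchy A B (e / 2) A0 B0; first by lra.
(* Multiplied by A * B, this bound stays below e / 4; the added 1 covers A * B = 0. *)
have [|d2 d20 h2] := @control_pow_small (e / (4 * (A * B) + 1) / 2).
  by rewrite !divr_gt0//; lra.
have d0 : 0 < Num.min d1 d2 by rewrite lt_min d10.
have : mesh_filter a b
    [set P | tagged_partition a b P /\ finer a b (Num.min d1 d2) P].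
  by exists (Num.min d1 d2).
move=> /[dup] mesh /filter_ex[Q [tQ fQ]].
have weaken d P : Num.min d1 d2 <= d ->
    finer a b (Num.min d1 d2) P -> finer a b d P.
  by move=> dd fP k kP; exact: lt_le_trans (fP k kP) dd.
have near P : tagged_partition a b P -> finer a b (Num.min d1 d2) P ->
  `|riemann_stieltjes_sum F g a b P - left_sum F g a P.1|
    <= A * B * (e / (4 * (A * B) + 1) / 2).
  move=> tP fP; rewrite (le_trans (tagged_sum_bound hF hg a0 b1 tP))//.
  rewrite ler_wpM2l// h2//; last by have [[_ /eqP->]] := tP.
  by apply: finer_path tP _; apply: weaken fP; rewrite ge_min lexx orbT.
exists (riemann_stieltjes_sum F g a b Q); apply: filterS mesh => P [tP fP] /=.
rewrite /ball /= -[_ - _](_ : (riemann_stieltjes_sum F g a b Q - left_sum F g a Q.1)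
  - (riemann_stieltjes_sum F g a b P - left_sum F g a P.1)
  + (left_sum F g a Q.1 - left_sum F g a P.1) = _); last by ring.
have hPQ : `|left_sum F g a Q.1 - left_sum F g a P.1| <= e / 2.
  apply: h1 hF hg a0 b1 _ _ _ _; first by case: tQ.
  - by case: tP.
  - by apply: finer_path tQ _; apply: weaken fQ; rewrite ge_min lexx.
  - by apply: finer_path tP _; apply: weaken fP; rewrite ge_min lexx.
have k : A * B * (e / (4 * (A * B) + 1) / 2) < e / 4.
  set x := e / (4 * (A * B) + 1); have x0 : 0 < x by rewrite divr_gt0//; lra.
  have ex : x * (4 * (A * B) + 1) = e by rewrite divfK// gt_eqF//; lra.
  have y0 : 0 <= A * B * x by rewrite mulr_ge0// ltW.
  lra.
have := near Q tQ fQ; have := near P tP fP => hP hQ.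
rewrite (le_lt_trans (ler_normD _ _))// (le_lt_trans (lerD (ler_normB _ _) hPQ))//.
lra.
Qed.

Lemma young_approx A B e : 0 <= A -> 0 <= B -> 0 < e ->
  exists2 d, 0 < d & forall F g a b r, holder w al A F -> holder w al B g ->
    0 <= a -> b <= 1 -> itv_partition a b r -> path (mesh_lt d) a r ->
    `|left_sum F g a r - young_integral F g a b| <= e.
Proof.
move=> A0 B0 e0.
have [|d1 d10 h1] := @left_sum_cauchy A B (e / 2) A0 B0; first by lra.
have AB0 : 0 <= A * B by exact: mulr_ge0.
have [|d2 d20 h2] := @control_pow_small (e / (4 * (A * B) + 1)).
  by rewrite !divr_gt0//; lra.
exists d1 => // F g a b r hF hg a0 b1 ir fr.
have ab : a <= b := itv_partition_le ir.
have FF := mesh_filter_proper ab.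
have /cvgrPdist_lt/(_ (e / 4))[|d3 d30 h3] := young_cvg hF hg a0 ab b1.
  by lra.
have d0 : 0 < Num.min d1 (Num.min d2 d3) by rewrite !lt_min d10 d20.
have weaken d P : Num.min d1 (Num.min d2 d3) <= d ->
    finer a b (Num.min d1 (Num.min d2 d3)) P -> finer a b d P.
  by move=> dd fP k kP; exact: lt_le_trans (fP k kP) dd.
have : mesh_filter a b [set P | tagged_partition a b P /\
    finer a b (Num.min d1 (Num.min d2 d3)) P].
  by exists (Num.min d1 (Num.min d2 d3)).
move=> /filter_ex[Q [tQ fQ]].
have fQ1 : finer a b d1 Q by apply: weaken fQ; rewrite ge_min lexx.
have fQ2 : finer a b d2 Q by apply: weaken fQ; rewrite !ge_min lexx orbT.
have fQ3 : finer a b d3 Q by apply: weaken fQ; rewrite !ge_min lexx !orbT.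
have := h3 Q (conj tQ fQ3); rewrite /= -/(young_integral F g a b) => k3.
have k1 : `|left_sum F g a r - left_sum F g a Q.1| <= e / 2.
  apply: h1 hF hg a0 b1 _ _ _ _ => //; first by case: tQ.
  exact: finer_path tQ _.
have := tagged_sum_bound hF hg a0 b1 tQ.
have {h2} := h2 a Q.1 (finer_path tQ fQ2) a0.
rewrite (_ : last a Q.1 = b); last by have [[_ /eqP->]] := tQ.
move=> /(_ b1) h2; move=> /le_trans/(_ (ler_wpM2l AB0 h2)) k2.
have k : A * B * (e / (4 * (A * B) + 1)) < e / 4.
  set x := e / (4 * (A * B) + 1); have x0 : 0 < x by rewrite divr_gt0//; lra.
  have ex : x * (4 * (A * B) + 1) = e by rewrite divfK// gt_eqF//; lra.
  lra.
move: k1 k2 k3 => /ler_normlP[? ?] /ler_normlP[? ?] /ltr_normlP[? ?].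
by apply/ler_normlP; split; lra.
Qed.

(** Along a fine partition the errors of H add up to at most M times a sum of w^(2 al), which tends
    to 0, while the left sums tend to the integral. The estimate is local (t - s < d), so that H may
    be defined piecewise, as in [form_integral_bump]. *)
Lemma young_unique A B F g H M d : holder w al A F -> holder w al B g ->
  0 <= M -> 0 < d ->
  (forall s t, 0 <= s -> s <= t -> t <= 1 -> t - s < d ->
    `|H t - H s - F s * (g t - g s)| <= M * w s t `^ (al + al)) ->
  forall a b, 0 <= a -> a <= b -> b <= 1 -> young_integral F g a b = H b - H a.
Proof.
move=> hF hg M0 d0 hH a b a0 ab b1; apply: eq_of_dist_le => e e0.
have [|d1 d10 h1] := @young_approx A B (e / 2) (proj1 hF) (proj1 hg).
  by lra.
have [|d2 d20 h2] := @control_pow_small (e / (2 * M + 1)).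
  by rewrite !divr_gt0//; lra.
have m0 : 0 < Num.min d (Num.min d1 d2) by rewrite !lt_min d0 d10.
have [r ir fr] := fine_partition ab m0.
have weaken d' : Num.min d (Num.min d1 d2) <= d' -> path (mesh_lt d') a r.
  move=> dd; apply: sub_path fr => u v /andP[/= uv h].
  by rewrite /mesh_lt /= uv (lt_le_trans h dd).
have fr0 : path (mesh_lt d) a r by apply: weaken; rewrite ge_min lexx.
have fr1 : path (mesh_lt d1) a r by apply: weaken; rewrite !ge_min lexx orbT.
have fr2 : path (mesh_lt d2) a r by apply: weaken; rewrite !ge_min lexx !orbT.
have k1 := h1 F g a b r hF hg a0 b1 ir fr1.
have lr : last a r = b by have [_ /eqP] := ir.
have k2 := h2 a r fr2 a0; rewrite lr in k2; have {}k2 := k2 b1.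
have k3 : `|H b - H a - left_sum F g a r| <= M * (e / (2 * M + 1)).
  rewrite -lr -chain_sum_telescope -chain_sumB.
  rewrite (le_trans (ler_norm_chain_sum _ _ _))//.
  rewrite (le_trans _ (ler_wpM2l M0 k2))// -chain_sumZ.
  apply: ler_chain_sum (fr0) a0 _; rewrite ?lr//; first exact: mesh_ltW.
  move=> u v /andP[/= uv vd] u0 v1.
  by rewrite hH// ltW.
have k : M * (e / (2 * M + 1)) <= e / 2.
  set x := e / (2 * M + 1); have x0 : 0 < x by rewrite divr_gt0//; lra.
  have ex : x * (2 * M + 1) = e by rewrite divfK// gt_eqF//; lra.
  lra.
move: k1 k3 => /ler_normlP[? ?] /ler_normlP[? ?].
by apply/ler_normlP; split; lra.
Qed.

(** Fine partitions of [0, s] and [s, t] concatenate to one of [0, t], so up to e the increment of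
    the integral is a left sum over [s, t], to which [left_sum_bound] applies. *)
Lemma young_increment A B F g s t : holder w al A F -> holder w al B g ->
  0 <= s -> s <= t -> t <= 1 ->
  `|young_integral F g 0 t - young_integral F g 0 s - F s * (g t - g s)|
    <= C * (A * B) * w s t `^ (al + al).
Proof.
move=> hF hg s0 st t1; apply/ler_addgt0Pr => e e0.
have [|d d0 hd] := @young_approx A B (e / 2) (proj1 hF) (proj1 hg).
  by lra.
have [r1 ir1 fr1] := fine_partition s0 d0.
have [r2 ir2 fr2] := fine_partition st d0.
have [p1 /eqP l1] := ir1; have [p2 /eqP l2] := ir2.
have k1 := hd F g 0 s r1 hF hg (lexx _) (le_trans st t1) ir1 fr1.
have k2 : `|left_sum F g 0 (r1 ++ r2) - young_integral F g 0 t| <= e / 2.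
  apply: hd hF hg (lexx _) t1 _ _; first exact: itv_partition_cat ir1 ir2.
  by rewrite cat_path fr1 l1.
have k3 := left_sum_bound hF hg p2 s0; rewrite l2 in k3; have {}k3 := k3 t1.
move: k2; rewrite [left_sum _ _ 0 (_ ++ _)]chain_sum_cat l1 -!/(left_sum _ _ _ _).
move: k1 k3 => /ler_normlP[? ?] /ler_normlP[? ?] /ler_normlP[? ?].
by apply/ler_normlP; split; lra.
Qed.

End Young.

(** * Chain rule and words *)

Section Germ.
Variables (R : realType) (w : R -> R -> R) (cw : control w) (al : R).
Hypothesis al2 : 1 < al + al.
Implicit Types (F G g H : R -> R) (X Y : R -> R -> R) (s t : R).

Definition is_holder (w : R -> R -> R) al F := exists A, holder w al A F.

Let al0 : 0 <= al. Proof. by have := al2; lra. Qed.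

Lemma holder_cst (c : R) : is_holder w al (fun=> c).
Proof.
exists 0; split=> // s t s0 st t1; rewrite subrr normr0 mul0r//.
Qed.

Lemma is_holder_eq F G : (forall t, 0 <= t <= 1 -> F t = G t) ->
  is_holder w al F -> is_holder w al G.
Proof.
move=> FG [A [A0 hF]]; exists A; split=> // s t s0 st t1.
by rewrite -!FG ?hF// ?s0 ?t1 ?(le_trans st)// (le_trans s0).
Qed.

Lemma holder_bounded F : is_holder w al F ->
  exists2 M, 0 <= M & forall t, 0 <= t <= 1 -> `|F t| <= M.
Proof.
move=> [A hF]; have A0 := proj1 hF.
exists (`|F 0| + A * w 0 1 `^ al); first by rewrite addr_ge0// mulr_ge0// powR_ge0.
move=> t /andP[t0 t1].
have := holder_le cw al2 hF (lexx 0) (lexx 0) t0 t1 (lexx 1).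
have := ler_normD (F 0) (F t - F 0); rewrite addrCA subrr addr0; lra.
Qed.

Lemma holderD F G : is_holder w al F -> is_holder w al G ->
  is_holder w al (fun t => F t + G t).
Proof.
move=> [A [A0 hF]] [B [B0 hG]]; exists (A + B); split; first exact: addr_ge0.
move=> s t s0 st t1; rewrite mulrDl.
have -> : F t + G t - (F s + G s) = (F t - F s) + (G t - G s) by ring.
by rewrite (le_trans (ler_normD _ _))// lerD ?hF ?hG.
Qed.

Lemma holderM F G : is_holder w al F -> is_holder w al G ->
  is_holder w al (fun t => F t * G t).
Proof.
move=> hF hG; have [M M0 bF] := holder_bounded hF.
have [N N0 bG] := holder_bounded hG.
move: hF hG => [A [A0 hF]] [B [B0 hG]].
exists (M * B + A * N); split; first by rewrite addr_ge0 ?mulr_ge0.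
move=> s t s0 st t1.
have s01 : 0 <= s <= 1 by rewrite s0 (le_trans st).
have t01 : 0 <= t <= 1 by rewrite t1 (le_trans s0).
have -> : F t * G t - F s * G s = F s * (G t - G s) + (F t - F s) * G t by ring.
rewrite (le_trans (ler_normD _ _))// !normrM mulrDl lerD//.
  by rewrite -mulrA ler_pM ?bF ?hG.
by rewrite mulrAC ler_pM ?bG ?hF.
Qed.

Lemma holderZ (c : R) F : is_holder w al F -> is_holder w al (fun t => c * F t).
Proof. by apply: holderM; exact: holder_cst. Qed.

Lemma holderX F n : is_holder w al F -> is_holder w al (fun t => F t ^+ n).
Proof.
move=> hF; elim: n => [|n IH]; first exact: holder_cst.
by apply: is_holder_eq (holderM hF IH) => t _; rewrite exprS.
Qed.

(* dH = X up to a remainder that the sewing bound makes negligible *)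
Definition germ H X := exists M, forall s t, 0 <= s -> s <= t -> t <= 1 ->
  `|H t - H s - X s t| <= M * w s t `^ (al + al).

Lemma germ_eq H G X Y : (forall t, 0 <= t <= 1 -> H t = G t) ->
  (forall s t, 0 <= s -> s <= t -> t <= 1 -> X s t = Y s t) ->
  germ H X -> germ G Y.
Proof.
move=> HG XY [M hM]; exists M => s t s0 st t1.
by rewrite -!HG -?XY// ?hM ?s0 ?t1 ?(le_trans st)// (le_trans s0).
Qed.

Lemma germD H G X Y : germ H X -> germ G Y ->
  germ (fun t => H t + G t) (fun s t => X s t + Y s t).
Proof.
move=> [M hM] [N hN]; exists (M + N) => s t s0 st t1.
have -> : H t + G t - (H s + G s) - (X s t + Y s t) =
  (H t - H s - X s t) + (G t - G s - Y s t) by ring.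
by rewrite mulrDl (le_trans (ler_normD _ _))// lerD ?hM ?hN.
Qed.

Lemma germZ c H X : germ H X -> germ (fun t => c * H t) (fun s t => c * X s t).
Proof.
move=> [M hM]; exists (`|c| * M) => s t s0 st t1.
by rewrite -!mulrBr normrM -mulrA ler_wpM2l ?hM.
Qed.

Lemma germ_cst c : germ (fun=> c) (fun _ _ => 0).
Proof.
by exists 0 => s t _ _ _; rewrite subr0 subrr normr0 mul0r.
Qed.

Lemma germ_sum (I : Type) (r : seq I) (H : I -> R -> R) (X : I -> R -> R -> R) :
  (forall i, germ (H i) (X i)) ->
  germ (fun t => \sum_(i <- r) H i t) (fun s t => \sum_(i <- r) X i s t).
Proof.
move=> hH; elim: r => [|i r IH].
  apply: germ_eq (germ_cst 0); first by move=> t _; rewrite big_nil.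
  by move=> s t _ _ _; rewrite big_nil.
apply: germ_eq (germD (hH i) IH); first by move=> t _; rewrite big_cons.
by move=> s t _ _ _; rewrite big_cons.
Qed.

Lemma germ_refl F : germ F (fun s t => F t - F s).
Proof.
by exists 0 => s t _ _ _; rewrite subrr normr0 mul0r.
Qed.

(** Leibniz rule: the product (F_t - F_s)(G_t - G_s) is O(w^(2 al)) and goes into the remainder. *)
Lemma germM F G X Y : is_holder w al F -> is_holder w al G ->
  germ F X -> germ G Y ->
  germ (fun t => F t * G t) (fun s t => F s * Y s t + G s * X s t).
Proof.
move=> hF hG [M hM] [N hN].
have [bF bF0 hbF] := holder_bounded hF; have [bG bG0 hbG] := holder_bounded hG.
move: hF hG => [A hF] [B hG].
exists (bF * N + bG * M + A * B) => s t s0 st t1.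
have s01 : 0 <= s <= 1 by rewrite s0 (le_trans st).
have -> : F t * G t - F s * G s - (F s * Y s t + G s * X s t) =
  F s * (G t - G s - Y s t) + G s * (F t - F s - X s t)
  + (F t - F s) * (G t - G s) by ring.
rewrite [leRHS]mulrDl (le_trans (ler_normD _ _))// lerD//; last first.
  by rewrite (holder_mul_le cw al2 hF hG).
rewrite [leRHS]mulrDl (le_trans (ler_normD _ _))// !normrM -!mulrA lerD//.
  by rewrite ler_pM ?hbF ?hN.
by rewrite ler_pM ?hbG ?hM.
Qed.

(** Induction with the Leibniz rule; at n = 0 the coefficient [n%:R] is 0, so the default value of
    [n.-1] is harmless. *)
Lemma germX F n : is_holder w al F ->
  germ (fun t => F t ^+ n) (fun s t => n%:R * F s ^+ n.-1 * (F t - F s)).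
Proof.
move=> hF; elim: n => [|n IH].
  by apply: germ_eq (germ_cst 1) => [//|s t _ _ _]; rewrite !mul0r.
apply: germ_eq (germM hF (holderX n hF) (germ_refl F) IH).
  by move=> t _; rewrite exprS.
move=> s t _ _ _ /=; case: n {IH} => [|n]; first by rewrite !expr0; ring.
by rewrite -[n.+2%:R]natr1 /= exprS; ring.
Qed.

(** H - G has germ 0. In [young_unique] for the integral of 0 against 0, both the zero function and
    H - G qualify as primitives, so H - G has zero increments. *)
Lemma germ_unique H G X : germ H X -> germ G X ->
  forall t, 0 <= t <= 1 -> H t - H 0 = G t - G 0.
Proof.
move=> hH /(germZ (-1)) hG.
have [M hM] : germ (fun t => H t - G t) (fun _ _ => 0).
  apply: germ_eq (germD hH hG) => [u _|s u _ _ _].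
    by rewrite mulN1r.
  by rewrite mulN1r subrr.
have h0 : holder w al 0 (fun=> 0).
  by split=> // s u _ _ _; rewrite subrr normr0 mul0r.
have U0 := young_unique cw al2 h0 h0.
move=> t /andP[t0 t1].
have e1 := U0 (fun=> 0) 0 1 (lexx _) ltr01 _ 0 t (lexx _) t0 t1.
have e2 := U0 (fun t => H t - G t) `|M| 1 (normr_ge0 _) ltr01 _ 0 t (lexx _) t0 t1.
have {}e1 : young_integral (fun=> 0) (fun=> 0) 0 t = 0 :> R.
  by rewrite e1 ?subrr// => s u _ _ _ _ /=; rewrite !(subrr, mulr0, normr0, mul0r).
move: e2; rewrite e1 => e2.
have : 0 = H t - G t - (H 0 - G 0).
  apply: e2 => s u s0 su u1 _; rewrite mul0r.
  by rewrite (le_trans (hM s u s0 su u1))// ler_wpM2r ?powR_ge0// ler_norm.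
lra.
Qed.

Lemma germ_young F g : is_holder w al F -> is_holder w al g ->
  germ (young_integral F g 0) (fun s t => F s * (g t - g s)).
Proof.
move=> [A hF] [B hg]; exists (sewing_const (al + al) * (A * B)) => s t s0 st t1.
exact: (young_increment cw al2 hF hg).
Qed.

(** [young_unique] is applied with the integral itself as H on the degenerate interval, which gives
    H 0 - H 0. *)
Lemma young_integral0 F g : is_holder w al F -> is_holder w al g ->
  young_integral F g 0 0 = 0.
Proof.
move=> [A hF] [B hg].
have A0 := proj1 hF; have B0 := proj1 hg.
have a2 := al2.
rewrite (young_unique cw al2 hF hg (H := young_integral F g 0)
  (M := sewing_const (al + al) * (A * B)) (d := 1)) ?subrr//.
  by apply: mulr_ge0; [exact/ltW/sewing_const_gt0 | exact: mulr_ge0].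
by move=> s t s0 st t1 _; exact: (young_increment cw al2 hF hg).
Qed.

Lemma young_germ F g H : is_holder w al F -> is_holder w al g ->
  germ H (fun s t => F s * (g t - g s)) ->
  forall t, 0 <= t <= 1 -> young_integral F g 0 t = H t - H 0.
Proof.
move=> hF hg hH t t01.
rewrite -(germ_unique (germ_young hF hg) hH t01) young_integral0// subr0//.
Qed.

(** Keeps the class of integrands closed under integration: w^(2 al) is at most w(0, 1)^al w^al. *)
Lemma germ_holder F g H : is_holder w al F -> is_holder w al g ->
  germ H (fun s t => F s * (g t - g s)) -> is_holder w al H.
Proof.
move=> hF [B [B0 hg]] [M hM]; have [N N0 bF] := holder_bounded hF.
exists (N * B + `|M| * w 0 1 `^ al); split.
  by rewrite addr_ge0 ?mulr_ge0// powR_ge0.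
move=> s t s0 st t1.
have s01 : 0 <= s <= 1 by rewrite s0 (le_trans st).
have -> : H t - H s = F s * (g t - g s) + (H t - H s - F s * (g t - g s)) by ring.
rewrite (le_trans (ler_normD _ _))// mulrDl lerD//.
  by rewrite normrM -mulrA ler_pM ?bF ?hg.
rewrite (le_trans (hM s t s0 st t1))//.
rewrite powRD; last by rewrite gt_eqF//; have := al2; lra.
rewrite mulrA ler_wpM2r ?powR_ge0//.
rewrite (le_trans (ler_wpM2r _ (ler_norm M))) ?powR_ge0// ler_wpM2l//.
by rewrite ge0_ler_powR ?nnegrE ?(control_ge0 cw) ?(control_le cw).
Qed.

Lemma holder_young F g : is_holder w al F -> is_holder w al g ->
  is_holder w al (young_integral F g 0).
Proof. by move=> hF hg; exact: germ_holder (germ_young hF hg). Qed.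

Lemma holder_lipschitz L F G Phi : 0 <= L ->
  (forall s t, 0 <= s -> s <= t -> t <= 1 ->
    `|Phi t - Phi s| <= L * (`|F t - F s| + `|G t - G s|)) ->
  forall A B, holder w al A F -> holder w al B G -> holder w al (L * (A + B)) Phi.
Proof.
move=> L0 hPhi A B [A0 hF] [B0 hG]; split; first by rewrite mulr_ge0// addr_ge0.
move=> s t s0 st t1; rewrite (le_trans (hPhi _ _ s0 st t1))// -mulrA ler_wpM2l//.
by rewrite mulrDl lerD ?hF ?hG.
Qed.

Lemma young_integralD F G g : is_holder w al F -> is_holder w al G ->
  is_holder w al g ->
  young_integral (fun t => F t + G t) g 0 1 =
    young_integral F g 0 1 + young_integral G g 0 1.
Proof.
move=> hF hG hg.
rewrite (young_germ (holderD hF hG) hg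
  (H := fun t => young_integral F g 0 t + young_integral G g 0 t)) ?ler01 ?lexx//.
  by rewrite !young_integral0// addr0 subr0.
apply: germ_eq (germD (germ_young hF hg) (germ_young hG hg)) => // s t _ _ _.
by rewrite mulrDl.
Qed.

Lemma young_integralZ c F g : is_holder w al F -> is_holder w al g ->
  young_integral (fun t => c * F t) g 0 1 = c * young_integral F g 0 1.
Proof.
move=> hF hg; rewrite (young_germ (holderZ c hF) hg
  (H := fun t => c * young_integral F g 0 t)) ?ler01 ?lexx//.
  by rewrite young_integral0// mulr0 subr0.
by apply: germ_eq (germZ c (germ_young hF hg)) => // s t _ _ _; rewrite mulrA.
Qed.

(** Continuity of the integral for uniform convergence of integrands with a common Hölder constant.
    One partition, fixed by [A] and g, approximates both integrals; on it the left sums differ by at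
    most h times the sum of the increments of g in absolute value. *)
Lemma young_close A g e : 0 <= A -> is_holder w al g -> 0 < e ->
  exists2 h, 0 < h & forall F G, holder w al A F -> holder w al A G ->
    (forall t, 0 <= t <= 1 -> `|F t - G t| <= h) ->
    `|young_integral F g 0 1 - young_integral G g 0 1| <= e.
Proof.
move=> A0 [B hg] e0.
have [|d d0 hd] := young_approx cw al2 (e := e / 3) A0 (proj1 hg); first by lra.
have [r ir fr] := fine_partition ler01 d0.
pose K := chain_sum (fun u v => `|g v - g u|) 0 r.
have K0 : 0 <= K by apply: chain_sum_ge0 => u v.
exists (e / (3 * (K + 1))); first by rewrite divr_gt0//; lra.
move=> F G hF hG FG.
have k1 := hd F g 0 1 r hF hg (lexx _) (lexx _) ir fr.
have k2 := hd G g 0 1 r hG hg (lexx _) (lexx _) ir fr.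
have lr : last 0 r = 1 by have [_ /eqP] := ir.
have k3 : `|left_sum F g 0 r - left_sum G g 0 r| <= e / (3 * (K + 1)) * K.
  rewrite -chain_sumB (le_trans (ler_norm_chain_sum _ _ _))// -chain_sumZ.
  apply: ler_chain_sum fr (lexx _) _; rewrite ?lr//; first exact: mesh_ltW.
  move=> u v /andP[/= uv _] u0 v1; rewrite -mulrBl normrM ler_wpM2r//.
  by rewrite FG// u0 (le_trans (ltW uv)).
have k4 : e / (3 * (K + 1)) * K <= e / 3.
  set x := e / (3 * (K + 1)); have x0 : 0 < x by rewrite divr_gt0//; lra.
  have ex : x * (3 * (K + 1)) = e by rewrite divfK// gt_eqF//; lra.
  lra.
move: k1 k2 k3 => /ler_normlP[? ?] /ler_normlP[? ?] /ler_normlP[? ?].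
by apply/ler_normlP; split; lra.
Qed.

End Germ.

(** * Monomials as linear combinations of iterated integrals *)

Section Words.
Variable R : realType.
Implicit Types (w : R -> R -> R) (gamma : R -> 'rV[R]_2) (F g : R -> R).

Lemma iterated_integral_rcons d (gamma : R -> 'rV[R]_d) a v i :
  iterated_integral gamma a (rcons v i) =
  young_integral (iterated_integral gamma a v) (fun u => gamma u 0 i) a.
Proof. by rewrite /iterated_integral foldl_rcons. Qed.

(** Each iterated integral is again an admissible integrand, so the limits defining the signature
    exist. *)
Lemma holder_iterated d (gamma : R -> 'rV[R]_d) w al v : control w -> 1 < al + al ->
  (forall i, is_holder w al (fun u => gamma u 0 i)) ->
  is_holder w al (iterated_integral gamma 0 v).
Proof.
move=> cw al2 hg; elim/last_ind: v => [|v i IH]; first exact: holder_cst.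
by rewrite iterated_integral_rcons; exact: holder_young.
Qed.

Lemma signature_iterated d (gamma gamma' : R -> 'rV[R]_d) a b :
  signature gamma a b = signature gamma' a b ->
  forall v, iterated_integral gamma a v b = iterated_integral gamma' a v b.
Proof.
move=> E v; have := congr1 (fun f : tensor_series R d => f (size v) (in_tuple v)) E.
by rewrite !ffunE.
Qed.

(** Iterated integrals see only increments, so the starting point is moved to the origin. *)
Definition centered d (gamma : R -> 'rV[R]_d) i t := gamma t 0 i - gamma 0 0 i.

Definition monomial m n gamma t := centered gamma 0 t ^+ m * centered gamma 1 t ^+ n.

Definition word_comb (W : seq (R * seq 'I_2)) gamma t : R :=
  \sum_(p <- W) p.1 * iterated_integral gamma 0 p.2 t.

Definition append i (W : seq (R * seq 'I_2)) := [seq (p.1, rcons p.2 i) | p <- W].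

Section Curve.
Variables (w : R -> R -> R) (cw : control w) (al : R) (al2 : 1 < al + al).
Variables (gamma : R -> 'rV[R]_2).
Hypothesis hgamma : forall i, is_holder w al (fun u => gamma u 0 i).

Lemma holder_centered i : is_holder w al (centered gamma i).
Proof. by apply: holderD => //; exact: holder_cst. Qed.

Lemma holder_monomial m n : is_holder w al (monomial m n gamma).
Proof. by apply: holderM => //; apply: holderX => //; exact: holder_centered. Qed.

(** Since the last letter is the outermost integral, integrating against coordinate [i] appends [i]
    to every word. *)
Lemma germ_word_comb W i :
  germ w al (word_comb (append i W) gamma)
    (fun s t => word_comb W gamma s * (gamma t 0 i - gamma s 0 i)).
Proof.
pose H (p : R * seq 'I_2) t := p.1 * iterated_integral gamma 0 (rcons p.2 i) t.
pose X (p : R * seq 'I_2) s t :=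
  p.1 * (iterated_integral gamma 0 p.2 s * (gamma t 0 i - gamma s 0 i)).
apply: (@germ_eq _ _ _ (fun t => \sum_(p <- W) H p t) _
  (fun s t => \sum_(p <- W) X p s t)).
- by move=> t _; rewrite /word_comb big_map.
- move=> s t _ _ _; rewrite /word_comb mulr_suml.
  by apply: eq_bigr => p _; rewrite /X mulrA.
apply: germ_sum => p; rewrite /H iterated_integral_rcons.
by apply/germZ/germ_young => //; exact: holder_iterated.
Qed.

Lemma word_comb_append0 W i : word_comb (append i W) gamma 0 = 0.
Proof.
rewrite /word_comb big_map big1// => p _.
rewrite iterated_integral_rcons (young_integral0 cw al2) ?mulr0//.
exact: holder_iterated.
Qed.

Lemma germ_monomial m n : germ w al (monomial m n gamma) (fun s t =>
  m%:R * monomial m.-1 n gamma s * (gamma t 0 0 - gamma s 0 0)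
  + n%:R * monomial m n.-1 gamma s * (gamma t 0 1 - gamma s 0 1)).
Proof.
have hx := holder_centered 0; have hy := holder_centered 1.
apply: germ_eq (germM cw al2 (holderX cw al2 m hx) (holderX cw al2 n hy)
  (germX cw al2 m hx) (germX cw al2 n hy)) => // s t _ _ _.
by rewrite /monomial /centered; ring.
Qed.

End Curve.

(** Induction on the degree through d(x^m y^n) = m x^(m-1) y^n dx + n x^m y^(n-1) dy: both sides
    have the same germ and vanish at 0. [W] is chosen before the curve, so one combination serves
    both curves. *)
Lemma monomial_word_comb m n : exists W, forall w al gamma,
  control w -> 1 < al + al -> (forall i, is_holder w al (fun u => gamma u 0 i)) ->
  forall t, 0 <= t <= 1 -> monomial m n gamma t = word_comb W gamma t.
Proof.
have [k] := ubnP (m + n); elim: k m n => [//|k IH] m n; rewrite ltnS => mnk.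
have [mn0|mn0] := eqVneq (m + n)%N 0%N.
  exists [:: (1, [::])] => w al gamma _ _ _ t _.
  have [-> ->] : m = 0%N /\ n = 0%N by lia.
  by rewrite /word_comb big_seq1 /monomial !expr0.
(* The alternative c = 0 handles m = 0 or n = 0, where the predecessor does not lower the degree. *)
have step c m' n' : (c = 0)%N \/ (m' + n' < k)%N -> exists W, forall w al gamma,
    control w -> 1 < al + al -> (forall i, is_holder w al (fun u => gamma u 0 i)) ->
    forall t, 0 <= t <= 1 -> c%:R * monomial m' n' gamma t = word_comb W gamma t.
  move=> [->|/IH[W hW]].
    exists [::] => w al gamma _ _ _ t _.
    by rewrite mul0r /word_comb big_nil.
  exists [seq (c%:R * p.1, p.2) | p <- W] => w al gamma cw al2 hg t t01.
  rewrite (hW w al)// /word_comb big_map mulr_sumr.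
  by apply: eq_bigr => p _; rewrite mulrA.
have [|W1 h1] := step m m.-1 n; first by lia.
have [|W2 h2] := step n m n.-1; first by lia.
exists (append 0 W1 ++ append 1 W2) => w al gamma cw al2 hg t t01.
have catE u : word_comb (append 0 W1 ++ append 1 W2) gamma u =
    word_comb (append 0 W1) gamma u + word_comb (append 1 W2) gamma u.
  by rewrite /word_comb big_cat.
have G1 := germ_monomial cw al2 hg m n.
have G2 : germ w al (word_comb (append 0 W1 ++ append 1 W2) gamma) (fun s t =>
  m%:R * monomial m.-1 n gamma s * (gamma t 0 0 - gamma s 0 0)
  + n%:R * monomial m n.-1 gamma s * (gamma t 0 1 - gamma s 0 1)).
  apply: germ_eq (germD (germ_word_comb cw al2 hg W1 0) (germ_word_comb cw al2 hg W2 1)).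
    by move=> u _; rewrite catE.
  move=> s u s0 su u1; have s01 : 0 <= s <= 1 by rewrite s0 (le_trans su).
  by rewrite (h1 w al)// (h2 w al).
have := germ_unique cw al2 G1 G2 t01.
rewrite !catE !(word_comb_append0 cw al2 hg) addr0 subr0 => <-.
rewrite [X in _ - X](_ : _ = 0) ?subr0// /monomial /centered !subrr.
by case: m n mn0 {mnk step h1 h2 G1 G2} => [|m] [|n]// _; rewrite !expr0n ?mul0r ?mulr0.
Qed.

Lemma young_monomial m n i : exists W, forall w al gamma,
  control w -> 1 < al + al -> (forall i, is_holder w al (fun u => gamma u 0 i)) ->
  young_integral (monomial m n gamma) (fun u => gamma u 0 i) 0 1 = word_comb W gamma 1.
Proof.
have [W hW] := monomial_word_comb m n; exists (append i W) => w al gamma cw al2 hg.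
rewrite (young_germ cw al2 (holder_monomial cw al2 hg m n) (hg i)
  (H := word_comb (append i W) gamma)) ?ler01 ?lexx//.
  by rewrite (word_comb_append0 cw al2 hg) subr0.
apply: germ_eq (germ_word_comb cw al2 hg W i) => // s t s0 st t1.
by rewrite (hW w al)// s0 (le_trans st).
Qed.

End Words.

(** * The q-variation control *)

Section UniformContinuity.
Variable R : realType.
Implicit Types (f g : R -> R) (a b : R).

Definition ucont f := forall e, 0 < e -> exists2 d, 0 < d &
  forall s t, 0 <= s <= 1 -> 0 <= t <= 1 -> `|s - t| < d -> `|f s - f t| < e.

Lemma heine f : {within `[0, 1], continuous f} -> ucont f.
Proof.
move=> /subspace_continuousP cf e e0.
(* In the near-covering form of compactness the modulus [d] is the parameter, tending to 0 from the
   right. *)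
have := @segment_compact R 0 1; rewrite compact_near_coveringP.
move=> /(_ R (0^'+) (fun d x => 0 <= x <= 1 -> forall y, 0 <= y <= 1 ->
  `|x - y| < d -> `|f x - f y| < e) _)[].
  move=> x x01; have /cvgrPdist_lt/(_ (e / 2)) := cf x x01.
  rewrite divr_gt0// => /(_ isT); rewrite near_withinE => /nbhs_ballP[r /= r0 hr].
  have h y : 0 <= y <= 1 -> `|x - y| < r -> `|f x - f y| < e / 2.
    by move=> y01 xy; apply: hr => //; rewrite /= in_itv.
  exists (ball x (r / 2), [set d | 0 < d < r / 2]) => /=; first split.
  - by apply: nbhsx_ballx; rewrite divr_gt0.
  - near=> d; apply/andP; split; near: d; first exact: nbhs_right_gt.
    by apply: nbhs_right_lt; rewrite divr_gt0.
  move=> [z d] /= [xz /andP[d0 dr]] z01 y y01 zy.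
  have xz2 : `|x - z| < r / 2 by [].
  have h1 := h z z01 (lt_trans xz2 _).
  have h2 := h y y01 _.
  have {}h1 : `|f x - f z| < e / 2 by apply: h1; lra.
  have {}h2 : `|f x - f y| < e / 2.
    apply: h2; have := ler_normD (x - z) (z - y).
    rewrite addrA subrK => /le_lt_trans; apply.
    by rewrite [ltRHS]splitr ltrD// (lt_trans zy).
  have := ler_normD (f z - f x) (f x - f y); rewrite addrA subrK (distrC (f z) (f x)); lra.
move=> d0 /= d00 hd; exists (d0 / 2); first by rewrite divr_gt0.
move=> s t s01 t01 st; apply: (hd (d0 / 2)) => //=.
- by rewrite sub0r normrN ger0_norm; lra.
- by rewrite divr_gt0.
Unshelve. all: by end_near. Qed.

Lemma ucont_within f a b : 0 <= a -> b <= 1 -> ucont f ->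
  {within `[a, b], continuous f}.
Proof.
move=> a0 b1 uf; apply/subspace_continuousP => x; rewrite /= in_itv /= => /andP[ax xb].
apply/cvgrPdist_lt => e /uf[d d0 hd]; rewrite near_withinE.
exists d => //= y xy; rewrite in_itv /= => /andP[ay yb].
by apply: hd => //; apply/andP; split; lra.
Qed.

End UniformContinuity.

(** * From finite p-variation to a control *)

Section VariationControl.
Variables (R : realType) (d : nat) (gamma : R -> 'rV[R]_d).
Implicit Types (p q a b s t e : R).

Lemma enorm_ge0 (v : 'rV[R]_d) : 0 <= enorm v.
Proof. exact: sqrtr_ge0. Qed.

Lemma coord_le_enorm (v : 'rV[R]_d) i : `|v 0 i| <= enorm v.
Proof.
rewrite -sqrtr_sqr ler_wsqrtr// (bigD1 i)//= lerDl sumr_ge0// => j _.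
exact: sqr_ge0.
Qed.

Lemma enorm_le_coord (v : 'rV[R]_d) e : (forall i, `|v 0 i| <= e) ->
  enorm v <= d%:R * e.
Proof.
case: d v => [|d'] v he; first by rewrite /enorm big_ord0 sqrtr0 mul0r.
have e0 : 0 <= e := le_trans (normr_ge0 _) (he ord0).
rewrite -(ger0_norm (mulr_ge0 (ler0n R d'.+1) e0)) -sqrtr_sqr ler_wsqrtr//.
apply: (@le_trans _ _ (\sum_(i < d'.+1) e ^+ 2)).
  apply: ler_sum => i _; rewrite -[v 0 i ^+ 2]ger0_norm ?sqr_ge0// normrX.
  by rewrite lerXn2r ?nnegrE.
rewrite sumr_const card_ord -[e ^+ 2 *+ _]mulr_natl exprMn ler_wpM2r ?sqr_ge0//.
by rewrite -natrX ler_nat expnS expn1 leq_pmulr.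
Qed.

Lemma ucont_coord i : {within `[0, 1], continuous gamma} ->
  ucont (fun u => gamma u 0 i).
Proof.
move=> /subspace_continuousP cg; apply/heine/subspace_continuousP => x x01.
exact: cvg_comp (cg x x01) (@coord_continuous _ _ _ 0 i (gamma x)).
Qed.

Lemma enorm_ucont e : {within `[0, 1], continuous gamma} -> 0 < e ->
  exists2 h, 0 < h & forall s t, 0 <= s <= 1 -> 0 <= t <= 1 -> `|s - t| < h ->
    enorm (gamma s - gamma t) <= e.
Proof.
move=> cg e0; pose e' := e / (d%:R + 1).
have e'0 : 0 < e' by rewrite divr_gt0// ltr_wpDl.
have [h h0 hh] : exists2 h, 0 < h & forall i s t, 0 <= s <= 1 -> 0 <= t <= 1 ->
    `|s - t| < h -> `|gamma s 0 i - gamma t 0 i| < e'.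
  have /choice[h hh] : forall i, exists h, 0 < h /\ forall s t, 0 <= s <= 1 ->
      0 <= t <= 1 -> `|s - t| < h -> `|gamma s 0 i - gamma t 0 i| < e'.
    by move=> i; have [h h0 hh] := ucont_coord i cg e'0; exists h.
  exists (\big[Num.min/1]_i h i).
    by elim/big_ind: _ => [//|x y x0 y0|i _]; [rewrite lt_min x0|case: (hh i)].
  move=> i s t s01 t01 st; apply: (hh i).2 => //; apply: lt_le_trans st _.
  exact: bigmin_le_cond.
exists h => // s t s01 t01 st.
apply: (le_trans (enorm_le_coord (e := e') _)).
  by move=> i; rewrite !mxE ltW// hh.
rewrite /e' mulrCA ler_piMr ?(ltW e0)// ler_pdivrMr ?mul1r ?lerDl//.
Qed.

Lemma pvar_sumE p a b r :
  pvar_sum p a b gamma r = chain_sum (fun u v => enorm (gamma v - gamma u) `^ p) a r.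
Proof. by rewrite -(chain_sumE _ a b). Qed.

Lemma finite_pvariation_chain p : finite_pvariation p 0 1 gamma ->
  exists2 V, 0 <= V & forall a r, path <%R a r -> 0 <= a -> last a r <= 1 ->
    chain_sum (fun u v => enorm (gamma v - gamma u) `^ p) a r <= V.
Proof.
rewrite /finite_pvariation; set S := ereal_sup _ => fS.
pose X u v := enorm (gamma v - gamma u) `^ p.
have X0 u v : 0 <= X u v by exact: powR_ge0.
have hS r : itv_partition 0 1 r -> ((chain_sum X 0 r)%:E <= S)%E.
  by move=> ir; apply: ereal_sup_ubound; exists r => //; rewrite pvar_sumE.
have S0 : (0 <= S)%E.
  apply: (le_trans _ (hS [:: 1] (itv_partition1 ltr01))).
  by rewrite lee_fin chain_sum_ge0.
have finS : S \is a fin_num by rewrite ge0_fin_numE.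
exists (fine S); first by rewrite fine_ge0.
move=> a r pr a0 r1.
(* The list is extended to a partition of [0, 1]; the tests avoid repeating an endpoint, since
   partitions increase strictly. *)
pose pre := if 0 < a then [:: a] else [::].
pose post : seq R := if last a r < 1 then [:: 1] else [::].
have lpre : last 0 pre = a.
  by rewrite /pre; case: ltP => //= a0'; apply/eqP; rewrite eq_le a0.
have part : itv_partition 0 1 (pre ++ r ++ post).
  split.
    rewrite !cat_path lpre pr /= /pre /post.
    by apply/andP; split; case: ifP => //= ->.
  rewrite !last_cat lpre /post; case: ltP => //= h.
  by rewrite eq_le r1.
rewrite -lee_fin fineK//; apply: le_trans (hS _ part).
rewrite lee_fin !chain_sum_cat lpre.
have h1 := @chain_sum_ge0 _ X 0 pre X0.
by have := @chain_sum_ge0 _ X (last a r) post X0; lra.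
Qed.

(** The q-th power of the q-variation; without the root it is superadditive. *)
Definition qvar q s t : R := sup [set pvar_sum q s t gamma r | r in itv_partition s t].

Variables (p q : R).
Hypotheses (p1 : 1 <= p) (pq : p < q).
Hypothesis cg : {within `[0, 1], continuous gamma}.
Hypothesis fg : finite_pvariation p 0 1 gamma.

Let qsum := chain_sum (fun u v => enorm (gamma v - gamma u) `^ q).

(** Interpolation: x^q <= e^(q-p) x^p for 0 <= x <= e. With q > p, small oscillation forces small
    q-variation, which makes [qvar] small on short intervals. *)
Lemma qsum_small : exists2 V, 0 <= V & forall e a r, 0 <= e ->
  path <%R a r -> 0 <= a -> last a r <= 1 ->
  (forall u v, a <= u -> u < v -> v <= last a r -> enorm (gamma v - gamma u) <= e) ->
  qsum a r <= e `^ (q - p) * V.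
Proof.
have [V V0 hV] := finite_pvariation_chain fg; exists V => // e a r e0 pr a0 r1 he.
apply: (@le_trans _ _ (e `^ (q - p) *
    chain_sum (fun u v => enorm (gamma v - gamma u) `^ p) a r)); last first.
  by rewrite ler_wpM2l ?powR_ge0// hV.
rewrite /qsum -chain_sumZ {hV}.
elim: r a pr a0 r1 he => [//|x r IH] a /= /andP[ax pr] a0 r1 he.
rewrite lerD//; last first.
  apply: IH => //; first by rewrite (le_trans a0)// ltW.
  by move=> u v xu uv vr; rewrite he// (le_trans (ltW ax)).
have := pq; have := p1 => p1' pq'.
have -> : enorm (gamma x - gamma a) `^ q =
    enorm (gamma x - gamma a) `^ (q - p) * enorm (gamma x - gamma a) `^ p.
  by rewrite -powRD subrK// gt_eqF//; lra.
rewrite ler_wpM2r ?powR_ge0// ge0_ler_powR ?nnegrE ?enorm_ge0//; first by lra.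
by rewrite he// path_le_last.
Qed.

(** [qsum_small] with e = W^(1/p), a bound on every increment read off from one-interval
    partitions. *)
Lemma qsum_bounded : exists2 V, 0 <= V & forall a r,
  path <%R a r -> 0 <= a -> last a r <= 1 -> qsum a r <= V.
Proof.
have [V V0 hV] := qsum_small.
have [W W0 hW] := finite_pvariation_chain fg.
exists ((W `^ p^-1) `^ (q - p) * V); first by rewrite mulr_ge0 ?powR_ge0.
move=> a r pr a0 r1; apply: hV => //; first exact: powR_ge0.
move=> u v au uv vr; have := hW u [:: v]; rewrite /= addr0 uv => /(_ isT).
move=> /(_ (le_trans a0 au) (le_trans vr r1)) h.
have p0 : p != 0 by rewrite gt_eqF//; have := p1; lra.
rewrite -[leLHS]powRr1 ?enorm_ge0// -[X in _ `^ X](divff p0) powRrM.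
by rewrite ge0_ler_powR ?nnegrE ?powR_ge0// invr_ge0; have := p1; lra.
Qed.

Let S s t := [set pvar_sum q s t gamma r | r in itv_partition s t].

Lemma qvar_has_sup s t : 0 <= s -> s <= t -> t <= 1 -> has_sup (S s t).
Proof.
move=> s0 st t1; have [V V0 hV] := qsum_bounded; split.
  have [r ir _] := fine_partition st ltr01.
  by exists (pvar_sum q s t gamma r), r.
exists V => _ [r [pr /eqP lr] <-]; rewrite pvar_sumE.
by apply: hV; rewrite // lr.
Qed.

Lemma control_qvar : control (qvar q).
Proof.
split.
- move=> s t s0 st t1; have hs := qvar_has_sup s0 st t1.
  have [_ [r ir _]] := hs.1.
  apply: (@le_trans _ _ (pvar_sum q s t gamma r)).
    by rewrite pvar_sumE chain_sum_ge0// => u v; exact: powR_ge0.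
  by apply: (sup_upper_bound hs); exists r.
- move=> s u t s0 su ut t1.
  have hst := qvar_has_sup s0 (le_trans su ut) t1.
  have hsu := qvar_has_sup s0 su (le_trans ut t1).
  have hut := qvar_has_sup (le_trans s0 su) ut t1.
  rewrite -lerBrDr; apply: ge_sup; first exact: hsu.1.
  move=> _ [r1 ir1 <-]; rewrite lerBrDr addrC -lerBrDr.
  apply: ge_sup; first exact: hut.1.
  move=> _ [r2 ir2 <-]; rewrite lerBrDr addrC.
  have -> : pvar_sum q s u gamma r1 + pvar_sum q u t gamma r2 =
      pvar_sum q s t gamma (r1 ++ r2).
    by rewrite !pvar_sumE chain_sum_cat; have [_ /eqP ->] := ir1.
  apply: (sup_upper_bound hst); exists (r1 ++ r2) => //.
  exact: itv_partition_cat ir1 ir2.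
- move=> e e0; have [V V0 hV] := qsum_small.
  have qp : q - p != 0 by rewrite gt_eqF// subr_gt0.
  (* With increments at most k^(1/(q-p)), [qsum_small] gives k V <= e / 2. *)
  pose k := e / (2 * (V + 1)); have k0 : 0 < k by rewrite divr_gt0//; lra.
  have e'0 : 0 < k `^ (q - p)^-1 by rewrite powR_gt0.
  have [h h0 hh] := enorm_ucont cg e'0.
  exists h => // s t s0 st t1 tsh; have hs := qvar_has_sup s0 st t1.
  apply: (@le_lt_trans _ _ (e / 2)); last by lra.
  apply: ge_sup; first exact: hs.1.
  move=> _ [r [pr /eqP lr] <-]; rewrite pvar_sumE.
  apply: (le_trans (hV (k `^ (q - p)^-1) s r (ltW e'0) pr s0 _ _)); rewrite ?lr//.
    move=> u v su uv vt; apply: hh.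
    - by apply/andP; split; lra.
    - by apply/andP; split; lra.
    - by rewrite ger0_norm; lra.
  rewrite -powRrM mulVf// powRr1 ?(ltW k0)//.
  have ek : k * (2 * (V + 1)) = e by rewrite divfK// gt_eqF//; lra.
  by have := mulr_ge0 (ltW k0) V0; lra.
Qed.

Lemma holder_qvar i : is_holder (qvar q) q^-1 (fun u => gamma u 0 i).
Proof.
exists 1; split=> // s t s0 st t1; rewrite mul1r.
have q0 : 0 < q by have := p1; have := pq; lra.
have h : enorm (gamma t - gamma s) `^ q <= qvar q s t.
  have := st; rewrite le_eqVlt => /predU1P[<-|st'].
    rewrite (control_xx control_qvar) ?(le_trans st)// subrr.
    rewrite /enorm big1 ?sqrtr0 ?powR0 ?gt_eqF//.
    by move=> j _; rewrite mxE expr0n.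
  apply: (sup_upper_bound (qvar_has_sup s0 (ltW st') t1)).
  by exists [:: t]; [exact: itv_partition1|rewrite pvar_sumE /= addr0].
apply: (@le_trans _ _ (enorm (gamma t - gamma s))).
  by have := coord_le_enorm (gamma t - gamma s) i; rewrite !mxE.
rewrite -[leLHS]powRr1 ?enorm_ge0// -[X in _ `^ X](divff (lt0r_neq0 q0)) powRrM.
rewrite ge0_ler_powR ?nnegrE ?powR_ge0 ?invr_ge0 ?(ltW q0)//.
exact: (control_ge0 control_qvar).
Qed.

End VariationControl.

(** * Bernstein polynomials and Lipschitz one-forms *)

Section Bernstein.
Variable R : realType.
Implicit Types (c : nat -> R) (u v k s D : R) (n : nat).

(* The Bernstein polynomial of degree n with control values c 0, ..., c n, by
   de Casteljau's recursion. *)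
Fixpoint bern n c u : R :=
  if n is m.+1 then (1 - u) * bern m c u + u * bern m (fun j => c j.+1) u else c 0%N.

Lemma bern_dist n c c' u D : 0 <= u <= 1 -> (forall j, `|c j - c' j| <= D) ->
  `|bern n c u - bern n c' u| <= D.
Proof.
move=> /andP[u0 u1]; elim: n c c' => [|n IH] c c' h /=; first exact: h.
have h1 := IH c c' h; have h2 := IH (c \o succn) (c' \o succn) (fun j => h j.+1).
set a := bern n c u in h1 *; set a' := bern n c' u in h1 *.
set b := bern _ (fun _ => _) u in h2 *; set b' := bern _ (fun j => c' _) u in h2 *.
have -> : (1 - u) * a + u * b - ((1 - u) * a' + u * b') =
  (1 - u) * (a - a') + u * (b - b') by ring.
rewrite (le_trans (ler_normD _ _))// !normrM (ger0_norm u0) ger0_norm ?subr_ge0//.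
have u1' : 0 <= 1 - u by lra.
have := ler_wpM2l u1' h1; have := ler_wpM2l u0 h2; lra.
Qed.

(** One step of the recursion adds (a' - a)(v - u), where a' - a compares control sequences shifted
    by one index and is at most D: the discrete form of differentiation. *)
Lemma bern_lipschitz n c u v D : 0 <= u <= 1 -> 0 <= v <= 1 ->
  (forall j, `|c j.+1 - c j| <= D) ->
  `|bern n c v - bern n c u| <= n%:R * D * `|v - u|.
Proof.
move=> u01 /andP[v0 v1]; elim: n c => [|n IH] c h /=.
  by rewrite subrr normr0 !mul0r.
have h1 := IH c h; have h2 := IH (c \o succn) (fun j => h j.+1).
have h3 : `|bern n (c \o succn) u - bern n c u| <= D by exact: bern_dist.
rewrite -[fun j => c j.+1]/(c \o succn).
set a := bern n c u in h1 h3 *; set b := bern n c v in h1 *.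
set a' := bern n (c \o succn) u in h2 h3 *; set b' := bern n (c \o succn) v in h2 *.
have -> : (1 - v) * b + v * b' - ((1 - u) * a + u * a') =
  (1 - v) * (b - a) + v * (b' - a') + (a' - a) * (v - u) by ring.
have -> : n.+1%:R * D * `|v - u| = n%:R * D * `|v - u| + D * `|v - u|.
  by rewrite -natr1; ring.
rewrite (le_trans (ler_normD _ _))// lerD//.
  rewrite (le_trans (ler_normD _ _))// !normrM (ger0_norm v0) ger0_norm ?subr_ge0//.
  have v1' : 0 <= 1 - v by lra.
  have := ler_wpM2l v1' h1; have := ler_wpM2l v0 h2; lra.
by rewrite normrM ler_wpM2r.
Qed.

(** The factor of [a] is the second moment about s of the binomial law with parameters n and u; it
    satisfies de Casteljau's recursion exactly. *)
Lemma bern_moment n c u k s a b : 0 <= u <= 1 ->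
  (forall j, `|c j - k| <= a * (j%:R - s) ^+ 2 + b) ->
  `|bern n c u - k| <= a * ((n%:R * u - s) ^+ 2 + n%:R * (u * (1 - u))) + b.
Proof.
move=> /andP[u0 u1]; elim: n c s => [|n IH] c s h /=.
  by have := h 0%N; rewrite !mul0r addr0.
have h1 := IH c s h.
have h2 : `|bern n (c \o succn) u - k| <=
    a * ((n%:R * u - (s - 1)) ^+ 2 + n%:R * (u * (1 - u))) + b.
  apply: IH => j /=; have := h j.+1; rewrite -natr1.
  by rewrite (_ : j%:R + 1 - s = j%:R - (s - 1)) //; ring.
rewrite -[fun j => c j.+1]/(c \o succn).
set x := bern n c u in h1 *; set y := bern n (c \o succn) u in h2 *.
have -> : (1 - u) * x + u * y - k = (1 - u) * (x - k) + u * (y - k) by ring.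
rewrite (le_trans (ler_normD _ _))// !normrM (ger0_norm u0) ger0_norm ?subr_ge0//.
have u1' : 0 <= 1 - u by lra.
rewrite (le_trans (lerD (ler_wpM2l u1' h1) (ler_wpM2l u0 h2)))// -natr1.
by rewrite le_eqVlt; apply/orP; left; apply/eqP; ring.
Qed.

(** Chebyshev's argument: |x| <= (x^2 + h^2) / (2 h) turns the Lipschitz bound into a second moment,
    and the variance of j / n is at most 1 / n <= h^2. *)
Lemma bern_approx n c (f : R -> R) u L h : 0 <= u <= 1 -> 0 <= L -> 0 < h ->
  1 <= n%:R * h ^+ 2 ->
  (forall x y, `|f x - f y| <= L * `|x - y|) ->
  (forall j, c j = f (j%:R / n%:R)) -> `|bern n c u - f u| <= L * h.
Proof.
move=> u01 L0 h0 nh hf hc.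
have n0 : 0 < n%:R :> R.
  by rewrite lt_neqAle ler0n andbT eq_sym; apply/eqP => e; move: nh; rewrite e mul0r; lra.
have := @bern_moment n c u (f u) (n%:R * u) (L / (2 * h * n%:R ^+ 2)) (L * h / 2) u01.
rewrite subrr expr0n add0r => /(_ _)/le_trans; apply.
  move=> j; rewrite hc (le_trans (hf _ _))//.
  have -> : L / (2 * h * n%:R ^+ 2) * (j%:R - n%:R * u) ^+ 2 + L * h / 2 =
      L * (((j%:R / n%:R - u) ^+ 2 + h ^+ 2) / (2 * h)).
    by field; rewrite !gt_eqF.
  rewrite ler_wpM2l// ler_pdivlMr; last by lra.
  rewrite -[(_ - _) ^+ 2]ger0_norm ?sqr_ge0// normrX.
  by have := sqr_ge0 (`|j%:R / n%:R - u| - h); rewrite sqrrB; lra.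
have -> : L / (2 * h * n%:R ^+ 2) * (n%:R * (u * (1 - u))) + L * h / 2 =
    L * (u * (1 - u) / (2 * h * n%:R) + h / 2).
  by field; rewrite !gt_eqF.
rewrite ler_wpM2l// [leRHS]splitr lerD2r ler_pdivrMr ?mulr_gt0//.
have uu : u * (1 - u) <= 1 by have := sqr_ge0 u; rewrite expr2; lra.
by rewrite (le_trans uu)// (le_trans nh)// le_eqVlt; apply/orP; left; apply/eqP; field.
Qed.

Definition lipschitz2 L (phi : R -> R -> R) := 0 <= L /\
  forall x y x' y', `|phi x' y' - phi x y| <= L * (`|x' - x| + `|y' - y|).

Definition bern2 n (phi : R -> R -> R) u v :=
  bern n (fun i => bern n (fun j => phi (i%:R / n%:R) (j%:R / n%:R)) v) u.

(** The constant does not grow with n: neighbouring control values differ by at most L / n, and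
    [bern_lipschitz] multiplies this by n. *)
Lemma bern2_lipschitz n L phi u v u' v' : (0 < n)%N -> lipschitz2 L phi ->
  0 <= u <= 1 -> 0 <= v <= 1 -> 0 <= u' <= 1 -> 0 <= v' <= 1 ->
  `|bern2 n phi u' v' - bern2 n phi u v| <= L * (`|u' - u| + `|v' - v|).
Proof.
move=> n0 [L0 hphi] u01 v01 u'01 v'01.
have nR : 0 < n%:R :> R by rewrite ltr0n.
have stepE i : i.+1%:R / n%:R - i%:R / n%:R = n%:R^-1 :> R.
  by rewrite -mulrBl -natr1 addrAC subrr add0r mul1r.
have nL : n%:R * (L / n%:R) = L by rewrite mulrCA divff ?mulr1 ?gt_eqF.
have -> : bern2 n phi u' v' - bern2 n phi u v =
  (bern2 n phi u' v' - bern2 n phi u v') + (bern2 n phi u v' - bern2 n phi u v) by ring.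
rewrite (le_trans (ler_normD _ _))// mulrDr lerD//.
  rewrite -{1}nL; apply: bern_lipschitz => // i; apply: bern_dist => // j.
  rewrite (le_trans (hphi _ _ _ _))// stepE subrr normr0 addr0.
  by rewrite ger0_norm// invr_ge0 ltW.
apply: bern_dist => // i; rewrite -{1}nL; apply: bern_lipschitz => // j.
rewrite (le_trans (hphi _ _ _ _))// stepE subrr normr0 add0r.
by rewrite ger0_norm// invr_ge0 ltW.
Qed.

Lemma bern2_approx L phi e : lipschitz2 L phi -> 0 < e ->
  exists2 n, (0 < n)%N & forall u v, 0 <= u <= 1 -> 0 <= v <= 1 ->
    `|bern2 n phi u v - phi u v| <= e.
Proof.
move=> [L0 hphi] e0; pose h := e / (2 * L + 1).
have h0 : 0 < h by rewrite divr_gt0//; lra.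
have he : h * (2 * L + 1) = e by rewrite divfK// gt_eqF//; lra.
(* n > h^(-2) gives n h^2 >= 1; each of the two variables then contributes an error L h. *)
pose n := (Num.truncn (h ^+ 2)^-1).+1.
have h20 : 0 < h ^+ 2 by rewrite exprn_gt0.
have nh : 1 <= n%:R * h ^+ 2.
  by rewrite -ler_pdivrMr// div1r ltW// truncnS_gt.
exists n => // u v u01 v01.
have -> : bern2 n phi u v - phi u v =
  (bern2 n phi u v - bern n (fun i => phi (i%:R / n%:R) v) u)
  + (bern n (fun i => phi (i%:R / n%:R) v) u - phi u v) by ring.
rewrite (le_trans (ler_normD _ _))// (@le_trans _ _ (L * h + L * h))//; last by lra.
rewrite lerD//.
  apply: bern_dist => // i; apply: bern_approx => // x y.
  by rewrite (le_trans (hphi _ _ _ _))// subrr normr0 add0r.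
apply: (@bern_approx n _ (fun x => phi x v)) => // x y.
by rewrite (le_trans (hphi _ _ _ _))// subrr normr0 addr0.
Qed.

End Bernstein.

Lemma ord2P (i : 'I_2) : i = 0 \/ i = 1.
Proof. by case: i => -[|[|//]] ?; [left|right]; exact: val_inj. Qed.

(** * One-forms whose integrals are determined by the signature *)

Section TestForms.
Variables (R : realType) (w w' : R -> R -> R) (cw : control w) (cw' : control w').
Variables (al : R) (al2 : 1 < al + al) (gamma gamma' : R -> 'rV[R]_2).
Hypothesis hgamma : forall i, is_holder w al (fun u => gamma u 0 i).
Hypothesis hgamma' : forall i, is_holder w' al (fun u => gamma' u 0 i).
Hypothesis same_words : forall v,
  iterated_integral gamma 0 v 1 = iterated_integral gamma' 0 v 1.

Definition pullback (gamma : R -> 'rV[R]_2) (phi : R -> R -> R) t :=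
  phi (centered gamma 0 t) (centered gamma 1 t).

Definition form_integral gamma phi i :=
  young_integral (pullback gamma phi) (fun u => gamma u 0 i) 0 1.

Let agree_form phi i := [/\ is_holder w al (pullback gamma phi),
  is_holder w' al (pullback gamma' phi) &
  form_integral gamma phi i = form_integral gamma' phi i].

(** Agreement is required for all monomial multiples of phi, which makes it stable under
    multiplication by x and y; Bernstein polynomials are then reached by their recursion, without
    expansion into monomials. *)
Let agree phi := forall m n i, agree_form (fun x y => x ^+ m * y ^+ n * phi x y) i.

Let agree_eq phi psi : (forall x y, phi x y = psi x y) -> agree phi -> agree psi.
Proof. by move=> e; rewrite (_ : phi = psi)//; apply/funext => x; apply/funext. Qed.

Let agree_formD phi psi i : agree_form phi i -> agree_form psi i ->
  agree_form (fun x y => phi x y + psi x y) i.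
Proof.
move=> [h1 h2 h3] [k1 k2 k3]; split; [exact: holderD|exact: holderD|].
rewrite /form_integral in h3 k3 *.
by rewrite (young_integralD cw al2 h1 k1)// (young_integralD cw' al2 h2 k2)// h3 k3.
Qed.

Let agreeD phi psi : agree phi -> agree psi -> agree (fun x y => phi x y + psi x y).
Proof.
move=> h k m n i; have := agree_formD (h m n i) (k m n i).
by congr agree_form; apply/funext => x; apply/funext => y; rewrite mulrDr.
Qed.

Let agreeZ c phi : agree phi -> agree (fun x y => c * phi x y).
Proof.
move=> h m n i; have [h1 h2 h3] := h m n i.
have -> : (fun x y => x ^+ m * y ^+ n * (c * phi x y)) =
  (fun x y => c * (x ^+ m * y ^+ n * phi x y)).
  by apply/funext => x; apply/funext => y; ring.
split; [exact: holderZ|exact: holderZ|].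
rewrite /form_integral in h3 *.
by rewrite (young_integralZ cw al2 c h1)// (young_integralZ cw' al2 c h2)// h3.
Qed.

Let agreeX phi : agree phi -> agree (fun x y => x * phi x y).
Proof.
move=> h m n i; have := h m.+1 n i.
by congr agree_form; apply/funext => x; apply/funext => y; rewrite exprS; ring.
Qed.

Let agreeY phi : agree phi -> agree (fun x y => y * phi x y).
Proof.
move=> h m n i; have := h m n.+1 i.
by congr agree_form; apply/funext => x; apply/funext => y; rewrite exprS; ring.
Qed.

Let agree1 : agree (fun _ _ => 1).
Proof.
move=> m n i.
have -> : (fun x y : R => x ^+ m * y ^+ n * 1) = (fun x y => x ^+ m * y ^+ n).
  by apply/funext => x; apply/funext => y; rewrite mulr1.
split; [exact: holder_monomial|exact: holder_monomial|].
have [W hW] := young_monomial R m n i.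
rewrite /form_integral (hW w al gamma)// (hW w' al gamma')//.
by apply: eq_bigr => p _; rewrite same_words.
Qed.

(** The recursion step is rewritten as h1 + g (h2 - h1), using only sums, multiples and the
    multiplier g. *)
Let agree_bern n (c : nat -> R -> R -> R) (g : R -> R -> R) :
  (forall phi, agree phi -> agree (fun x y => g x y * phi x y)) ->
  (forall j, agree (c j)) -> agree (fun x y => bern n (fun j => c j x y) (g x y)).
Proof.
move=> hg; elim: n c => [|n IH] c hc; first exact: hc.
have h1 := IH c hc; have h2 := IH (fun j => c j.+1) (fun j => hc j.+1).
apply: agree_eq (agreeD h1 (hg _ (agreeD h2 (agreeZ (-1) h1)))) => x y /=.
by ring.
Qed.

Lemma form_integral_eq L phi i : lipschitz2 L phi ->
  form_integral gamma phi i = form_integral gamma' phi i.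
Proof.
move=> [L0 hphi].
have bounded_curve w0 (gamma0 : R -> 'rV[R]_2) : control w0 ->
  (forall i, is_holder w0 al (fun u => gamma0 u 0 i)) ->
  exists2 M, 0 <= M & forall j t, 0 <= t <= 1 -> `|centered gamma0 j t| <= M.
  move=> cw0 h0.
  have [M0 M00 hM0] := holder_bounded cw0 al2 (holder_centered h0 0).
  have [M1 M10 hM1] := holder_bounded cw0 al2 (holder_centered h0 1).
  exists (M0 + M1) => [|j t t01]; first exact: addr_ge0.
  by case: (ord2P j) => ->; [have := hM0 t t01|have := hM1 t t01]; lra.
have [M M0 hM] := bounded_curve w gamma cw hgamma.
have [M' M'0 hM'] := bounded_curve w' gamma' cw' hgamma'.
pose N := M + M' + 1; have N0 : 0 < N by rewrite /N; lra.
(* Maps [-N, N], which contains the coordinates of both centered curves, onto [0, 1], where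
   Bernstein polynomials converge. *)
pose g x := (x + N) / (2 * N).
have g01 x : `|x| <= N -> 0 <= g x <= 1.
  move=> /ler_normlP[h1 h2]; rewrite divr_ge0/=; [|lra..].
  by rewrite ler_pdivrMr; lra.
pose psi u v := phi (2 * N * u - N) (2 * N * v - N).
have psiE x y : psi (g x) (g y) = phi x y.
  by rewrite /psi /g; congr phi; field; rewrite gt_eqF.
have psiL : lipschitz2 (2 * N * L) psi.
  split; first by rewrite !mulr_ge0// ltW.
  move=> x y x' y'; rewrite (le_trans (hphi _ _ _ _))//.
  have aff a b : `|2 * N * a - N - (2 * N * b - N)| = 2 * N * `|a - b|.
    rewrite (_ : _ - _ = 2 * N * (a - b)); last by ring.
    by rewrite normrM ger0_norm//; lra.
  by rewrite !aff le_eqVlt; apply/orP; left; apply/eqP; ring.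
have gL a b : `|g a - g b| = `|a - b| / (2 * N).
  rewrite (_ : g a - g b = (a - b) / (2 * N)); last by rewrite /g; ring.
  by rewrite normrM [X in _ * X]ger0_norm// invr_ge0; lra.
(* The factor 2 N in the Lipschitz constant of [psi] cancels the contraction by [g], so all
   approximants share the Hölder constant of phi along the curve, as [young_close] requires. *)
have close w0 (gamma0 : R -> 'rV[R]_2) : control w0 ->
  (forall i, is_holder w0 al (fun u => gamma0 u 0 i)) ->
  (forall j t, 0 <= t <= 1 -> `|centered gamma0 j t| <= N) ->
  is_holder w0 al (pullback gamma0 phi) /\ forall e, 0 < e -> exists2 h, 0 < h &
    forall n, (0 < n)%N ->
    (forall u v, 0 <= u <= 1 -> 0 <= v <= 1 -> `|bern2 n psi u v - psi u v| <= h) ->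
    `|form_integral gamma0 phi i
      - form_integral gamma0 (fun x y => bern2 n psi (g x) (g y)) i| <= e.
  move=> cw0 h0 bN.
  have [A0 hA0] := holder_centered h0 0.
  have [A1 hA1] := holder_centered h0 1.
  have hF : holder w0 al (L * (A0 + A1)) (pullback gamma0 phi).
    by apply: (holder_lipschitz L0 _ hA0 hA1) => s t _ _ _; exact: hphi.
  split=> [|e e0]; first by exists (L * (A0 + A1)).
  have [h h0' hh] := young_close cw0 al2 (proj1 hF) (h0 i) e0.
  exists h => // n n0 hn; apply: hh => // [|t t01].
    apply: (holder_lipschitz L0 _ hA0 hA1) => s t s0 st t1.
    have s01 : 0 <= s <= 1 by rewrite s0 (le_trans st).
    have t01 : 0 <= t <= 1 by rewrite t1 (le_trans s0).
    rewrite (le_trans (bern2_lipschitz n0 psiL _ _ _ _))// ?g01 ?bN//.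
    rewrite !gL -mulrDl le_eqVlt; apply/orP; left; apply/eqP.
    by field; rewrite gt_eqF.
  by rewrite /pullback -psiE distrC hn ?g01 ?bN.
have [|_ c] := close w gamma cw hgamma.
  by move=> j t t01; have := hM j t t01; rewrite /N; lra.
have [|_ c'] := close w' gamma' cw' hgamma'.
  by move=> j t t01; have := hM' j t t01; rewrite /N; lra.
apply: eq_of_dist_le => e e0.
have [|h h0 hh] := c (e / 2); first by lra.
have [|h' h'0 hh'] := c' (e / 2); first by lra.
have m0 : 0 < Num.min h h' by rewrite lt_min h0.
have [n n0 hn] := bern2_approx psiL m0.
have mh : Num.min h h' <= h by rewrite ge_min lexx.
have mh' : Num.min h h' <= h' by rewrite ge_min lexx orbT.
have b1 := hh n n0 (fun u v u01 v01 => le_trans (hn u v u01 v01) mh).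
have b2 := hh' n n0 (fun u v u01 v01 => le_trans (hn u v u01 v01) mh').
have aX (q : R -> R -> R) : agree q -> agree (fun x y => g x * q x y).
  move=> hq; apply: agree_eq (agreeD (agreeZ (2 * N)^-1 (agreeX hq))
    (agreeZ (N / (2 * N)) hq)) => x y.
  by rewrite /g; ring.
have aY (q : R -> R -> R) : agree q -> agree (fun x y => g y * q x y).
  move=> hq; apply: agree_eq (agreeD (agreeZ (2 * N)^-1 (agreeY hq))
    (agreeZ (N / (2 * N)) hq)) => x y.
  by rewrite /g; ring.
have : agree (fun x y => bern2 n psi (g x) (g y)).
  apply: (@agree_bern n (fun j _ y => bern n (fun k => psi (j%:R / n%:R) (k%:R / n%:R))
    (g y)) (fun x _ => g x)) => // j.
  apply: (@agree_bern n (fun k _ _ => psi (j%:R / n%:R) (k%:R / n%:R))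
    (fun _ y => g y)) => // k.
  apply: agree_eq (agreeZ (psi (j%:R / n%:R) (k%:R / n%:R)) agree1) => x y.
  by rewrite mulr1.
move=> /(_ 0%N 0%N i)[_ _].
rewrite (_ : (fun x y => x ^+ 0 * y ^+ 0 * bern2 n psi (g x) (g y)) =
  (fun x y => bern2 n psi (g x) (g y))); last first.
  by apply/funext => x; apply/funext => y; rewrite !expr0 !mul1r.
move: b1 b2 => /ler_normlP[? ?] /ler_normlP[? ?] ?.
by apply/ler_normlP; split; lra.
Qed.

End TestForms.

(** * Cutoffs *)

Section Smoothstep.
Variable R : realType.
Implicit Types u v : R.

Definition clamp u : R := Num.max 0 (Num.min 1 u).
(** A C^1 step from 0 to 1 whose derivative [dsmoothstep] is Lipschitz; differentiability enters
    only through the quadratic bound [smoothstep_taylor]. *)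
Definition smoothstep u := 3 * clamp u ^+ 2 - 2 * clamp u ^+ 3.
Definition dsmoothstep u := 6 * clamp u * (1 - clamp u).

Lemma clampP u : [\/ u <= 0 /\ clamp u = 0, 0 <= u <= 1 /\ clamp u = u |
  1 <= u /\ clamp u = 1].
Proof.
rewrite /clamp; have [u0|u0] := leP u 0.
  by constructor 1; split=> //; rewrite min_r ?max_l//; lra.
have [u1|u1] := leP u 1; first by constructor 2; split; rewrite ?max_r//; lra.
by constructor 3; split; rewrite ?max_r// ltW.
Qed.

Lemma smoothstep0 u : u <= 0 -> smoothstep u = 0 /\ dsmoothstep u = 0.
Proof.
rewrite /smoothstep /dsmoothstep => u0.
have -> : clamp u = 0 by case: (clampP u) => -[? ->//]; lra.
by rewrite !expr0n /= !mulr0 subrr mul0r.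
Qed.

Lemma smoothstep1 u : 1 <= u -> smoothstep u = 1 /\ dsmoothstep u = 0.
Proof.
rewrite /smoothstep /dsmoothstep => u0.
have -> : clamp u = 1 by case: (clampP u) => -[? ->//]; lra.
by rewrite !expr1n subrr; split; ring.
Qed.

Lemma clamp_itv u : 0 <= clamp u <= 1.
Proof. by case: (clampP u) => -[? ->]; lra. Qed.

Lemma clamp_lipschitz u v : `|clamp v - clamp u| <= `|v - u|.
Proof.
by rewrite ler_norml; case: (clampP u) => -[? ->]; case: (clampP v) => -[? ->];
  case: (ger0P (v - u)) => ?; lra.
Qed.

Lemma dsmoothstep_bound u : `|dsmoothstep u| <= 6.
Proof.
rewrite /dsmoothstep; have /andP[c0 c1] := clamp_itv u; set c := clamp u in c0 c1 *.
have : 0 <= c * (1 - c) by rewrite mulr_ge0// subr_ge0.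
by move=> h; rewrite ler_norml; have := sqr_ge0 c; rewrite expr2; lra.
Qed.

Lemma dsmoothstep_lipschitz u v : `|dsmoothstep v - dsmoothstep u| <= 6 * `|v - u|.
Proof.
have /andP[c0 c1] := clamp_itv u; have /andP[e0 e1] := clamp_itv v.
rewrite /dsmoothstep (_ : _ - _ = 6 * ((clamp v - clamp u) * (1 - clamp u - clamp v))).
  rewrite normrM ger0_norm// ler_wpM2l// normrM -[leRHS]mulr1.
  by rewrite ler_pM ?clamp_lipschitz// ler_norml; lra.
by ring.
Qed.

Lemma smoothstep_taylor u v :
  `|smoothstep v - smoothstep u - dsmoothstep u * (v - u)| <= 9 * (v - u) ^+ 2.
Proof.
pose a := clamp u; pose b := clamp v.
(* The first term is the Taylor remainder of 3 x^2 - 2 x^3 at the clamped points, the second the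
   error made by clamping. The latter is quadratic: a (1 - a) is at most the distance from u to the
   endpoint that v has passed. *)
have -> : smoothstep v - smoothstep u - dsmoothstep u * (v - u) =
   (b - a) ^+ 2 * (3 - 4 * a - 2 * b) + 6 * (a * (1 - a) * ((b - a) - (v - u))).
  by rewrite /smoothstep /dsmoothstep -/a -/b; ring.
have /andP[a0 a1] := clamp_itv u; have /andP[b0 b1] := clamp_itv v.
rewrite -/a -/b in a0 a1 b0 b1.
have h1 : `|(b - a) ^+ 2 * (3 - 4 * a - 2 * b)| <= 3 * (v - u) ^+ 2.
  rewrite normrM normrX mulrC ler_pM ?sqr_ge0//.
    by rewrite ler_norml; lra.
  by rewrite -[leRHS]ger0_norm ?sqr_ge0// normrX lerXn2r ?nnegrE// clamp_lipschitz.
have h2 : `|a * (1 - a) * ((b - a) - (v - u))| <= (v - u) ^+ 2.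
  have v2 := sqr_ge0 (v - u).
  rewrite /a /b; case: (clampP u) => -[u1 ->].
  - by rewrite !mul0r normr0.
  - case: (clampP v) => -[v1 ->].
    + rewrite ler_norml; apply/andP; split; nra.
    + by rewrite subrr mulr0 normr0.
    + have p0 : 0 <= 1 - u by lra.
      have r0 : 0 <= v - 1 by lra.
      have u0 : 0 <= u by lra.
      have pr0 := mulr_ge0 p0 r0.
      have := mulr_ge0 u0 pr0; have := mulr_ge0 p0 pr0.
      have := sqr_ge0 (1 - u); have := sqr_ge0 (v - 1).
      by rewrite ler_norml => *; apply/andP; split; lra.
  - by rewrite subrr mulr0 mul0r normr0.
rewrite (le_trans (ler_normD _ _))// (normrM 6) [`|6|]ger0_norm//; lra.
Qed.

End Smoothstep.

(** * Distance to an arc and Lipschitz cutoffs *)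

Section Bump.
Variable R : realType.
Implicit Types (x y s t u v a b : R) (X Y : R -> R).

Lemma ucont_lipschitz2 L phi X Y : lipschitz2 L phi -> ucont X -> ucont Y ->
  ucont (fun t => phi (X t) (Y t)).
Proof.
move=> [L0 hphi] uX uY e e0.
have e'0 : 0 < e / (2 * L + 1) by rewrite divr_gt0//; lra.
have [d1 d10 h1] := uX _ e'0; have [d2 d20 h2] := uY _ e'0.
exists (Num.min d1 d2); first by rewrite lt_min d10.
move=> s t s01 t01; rewrite lt_min => /andP[st1 st2].
have k1 := h1 s t s01 t01 st1; have k2 := h2 s t s01 t01 st2.
apply: (le_lt_trans (hphi _ _ _ _)); move: k1 k2.
have : e / (2 * L + 1) * (2 * L + 1) = e by rewrite divfK// gt_eqF//; lra.
set x := e / _ in e'0 *; set y := `|X s - X t|; set z := `|Y s - Y t| => ex hy hz.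
by have := ler_wpM2l L0 (lerD (ltW hy) (ltW hz)); lra.
Qed.

Lemma lipschitz2M L M f L' M' g : 0 <= M -> 0 <= M' ->
  lipschitz2 L f -> (forall x y, `|f x y| <= M) ->
  lipschitz2 L' g -> (forall x y, `|g x y| <= M') ->
  lipschitz2 (L * M' + M * L') (fun x y : R => f x y * g x y).
Proof.
move=> M0 M'0 [L0 hf] bf [L'0 hg] bg; split; first by rewrite addr_ge0// mulr_ge0.
move=> x y x' y'; have := hf x y x' y'; have := hg x y x' y'.
set D := `|x' - x| + `|y' - y| => kg kf.
have -> : f x' y' * g x' y' - f x y * g x y =
  (f x' y' - f x y) * g x' y' + f x y * (g x' y' - g x y) by ring.
rewrite (le_trans (ler_normD _ _))// !normrM mulrDl lerD//.
  by rewrite mulrAC ler_pM.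
by rewrite -mulrA ler_pM.
Qed.

Variables (X Y : R -> R) (uX : ucont X) (uY : ucont Y).
Variables (s t : R) (s0 : 0 <= s) (st : s <= t) (t1 : t <= 1).

Let dset x y := [set `|x - X v| + `|y - Y v| | v in `[s, t]].

(** The distance to the arc in the l1 norm, the one used in [lipschitz2]. *)
Definition arc_dist x y := inf (dset x y).

Let dset_inf x y : has_inf (dset x y).
Proof.
split; first by exists (`|x - X s| + `|y - Y s|), s => //=; rewrite in_itv /= lexx.
by exists 0 => _ [v _ <-]; rewrite addr_ge0.
Qed.

Lemma arc_dist_le x y v : s <= v <= t -> arc_dist x y <= `|x - X v| + `|y - Y v|.
Proof.
by move=> vst; apply: ge_inf; [exact: (dset_inf x y).2|exists v => //=; rewrite in_itv].
Qed.

Lemma arc_dist_ge x y k : (forall v, s <= v <= t -> k <= `|x - X v| + `|y - Y v|) ->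
  k <= arc_dist x y.
Proof.
move=> h; apply: lb_le_inf; first exact: (dset_inf x y).1.
by move=> _ [v /= + <-]; rewrite in_itv /= => /h.
Qed.

Lemma arc_dist0 v : s <= v <= t -> arc_dist (X v) (Y v) = 0.
Proof.
move=> vst; apply/eqP; rewrite eq_le arc_dist_ge ?andbT; last first.
  by move=> u _; rewrite addr_ge0.
by rewrite (le_trans (arc_dist_le _ _ vst))// !subrr normr0 addr0.
Qed.

Lemma arc_dist_lipschitz : lipschitz2 1 arc_dist.
Proof.
have one x y x' y' : arc_dist x' y' <= arc_dist x y + (`|x' - x| + `|y' - y|).
  rewrite -lerBlDr; apply: arc_dist_ge => v vst.
  have := arc_dist_le x' y' vst.
  have := ler_normD (x' - x) (x - X v); have := ler_normD (y' - y) (y - Y v).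
  by rewrite !addrA !subrK; lra.
split=> // x y x' y'; rewrite mul1r ler_norml.
have := one x y x' y'; have := one x' y' x y.
by rewrite (distrC x) (distrC y); lra.
Qed.

Lemma arc_dist_gt0 x y : (forall v, s <= v <= t -> X v = x -> Y v <> y) ->
  0 < arc_dist x y.
Proof.
move=> xyN; have lip : lipschitz2 1 (fun p q => `|x - p| + `|y - q|).
  split=> // p q p' q'; rewrite mul1r.
  have h1 := ler_dist_dist (x - p') (x - p); have h2 := ler_dist_dist (y - q') (y - q).
  have e1 : x - p' - (x - p) = - (p' - p) by ring.
  have e2 : y - q' - (y - q) = - (q' - q) by ring.
  rewrite e1 normrN in h1; rewrite e2 normrN in h2.
  have -> : `|x - p'| + `|y - q'| - (`|x - p| + `|y - q|) =
   (`|x - p'| - `|x - p|) + (`|y - q'| - `|y - q|) by ring.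
  by rewrite (le_trans (ler_normD _ _))// lerD.
have [c] := EVT_min st (ucont_within s0 t1 (ucont_lipschitz2 lip uX uY)).
rewrite in_itv /= => cst hc.
apply: (@lt_le_trans _ _ (`|x - X c| + `|y - Y c|)); last first.
  by apply: arc_dist_ge => v vst; apply: hc; rewrite in_itv.
rewrite lt0r addr_ge0// andbT paddr_eq0// !normr_eq0 !subr_eq0.
by apply/negP => /andP[/eqP ex /eqP ey]; exact: xyN cst (esym ex) (esym ey).
Qed.

(** Disjoint compact arcs are at positive distance, as [arc_dist] attains a minimum along the second
    one. *)
Lemma arc_separated (X' Y' : R -> R) a b : 0 <= a -> a <= b -> b <= 1 ->
  ucont X' -> ucont Y' ->
  (forall u v, a <= u <= b -> s <= v <= t -> X v = X' u -> Y v <> Y' u) ->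
  exists2 k, 0 < k & forall u, a <= u <= b -> k <= arc_dist (X' u) (Y' u).
Proof.
move=> a0 ab b1 uX' uY' sep.
have [c] := EVT_min ab (ucont_within a0 b1 (ucont_lipschitz2 arc_dist_lipschitz uX' uY')).
rewrite in_itv /= => cab hc; exists (arc_dist (X' c) (Y' c)).
  exact: arc_dist_gt0 (fun v => sep c v cab).
by move=> u uab; apply: hc; rewrite in_itv.
Qed.

Definition arc_bump k x y := clamp (1 - arc_dist x y / k).

Lemma arc_bump_lipschitz k : 0 < k -> lipschitz2 k^-1 (arc_bump k).
Proof.
move=> k0; have [_ lip] := arc_dist_lipschitz.
split; first by rewrite invr_ge0 ltW.
move=> x y x' y'; rewrite (le_trans (clamp_lipschitz _ _))//.
have -> : 1 - arc_dist x' y' / k - (1 - arc_dist x y / k) =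
  - (k^-1 * (arc_dist x' y' - arc_dist x y)) by ring.
rewrite normrN normrM ger0_norm ?invr_ge0 ?(ltW k0)// ler_wpM2l ?invr_ge0 ?(ltW k0)//.
by have := lip x y x' y'; rewrite mul1r.
Qed.

Lemma arc_bump1 k v : s <= v <= t -> arc_bump k (X v) (Y v) = 1.
Proof.
move=> vst; rewrite /arc_bump arc_dist0// mul0r subr0.
by case: (clampP (1 : R)) => -[h ->]//; move: h; lra.
Qed.

Lemma arc_bump0 k x y : 0 < k -> k <= arc_dist x y -> arc_bump k x y = 0.
Proof.
move=> k0 kd; have : 1 - arc_dist x y / k <= 0.
  by rewrite subr_le0 ler_pdivlMr// mul1r.
by rewrite /arc_bump; case: (clampP (1 - arc_dist x y / k)) => -[? ->//]; lra.
Qed.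

End Bump.

(** * The signature determines the trace *)

Section Trace.
Variable R : realType.
Implicit Types (gamma : R -> 'rV[R]_2) (s t u v a b k : R).

Definition coord (i : 'I_2) (x y : R) := if i == 0 then x else y.

Lemma coordE (i : 'I_2) gamma t :
  coord i (centered gamma 0 t) (centered gamma 1 t) = centered gamma i t.
Proof.
by case: (ord2P i) => ->.
Qed.

Lemma ord2_neq (v v' : 'rV[R]_2) : v != v' -> exists i, v 0 i != v' 0 i.
Proof.
move=> vv'; have [e0|] := eqVneq (v 0 0) (v' 0 0); last by exists 0.
exists 1; apply: contra_neq vv' => e1; apply/rowP => i.
by case: (ord2P i) => ->.
Qed.

Section OneCurve.
Variables (w : R -> R -> R) (cw : control w) (al : R) (al2 : 1 < al + al).
Variable gamma : R -> 'rV[R]_2.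
Hypothesis hgamma : forall i, is_holder w al (fun u => gamma u 0 i).

Lemma form_integral0 phi i :
  (forall t, 0 <= t <= 1 -> pullback gamma phi t = 0) ->
  form_integral gamma phi i = 0.
Proof.
move=> phi0; have h0 : is_holder w al (pullback gamma phi).
  by apply: is_holder_eq (holder_cst w al 0) => t t01; rewrite phi0.
have [A hA] := h0; have [B hB] := hgamma i.
rewrite /form_integral (young_unique cw al2 hA hB (H := fun=> 0) (M := 0) (d := 1)) ?subrr//.
move=> s t s0 st t1 _; rewrite phi0 ?s0 ?(le_trans st)//.
by rewrite !(mul0r, subrr, normr0).
Qed.

(* The integrand is chi times a derivative d/dz h(z_i), with chi a cutoff of the
   arc gamma([s, t]) and h a step that is constant near the ends of the arc. *)
Lemma form_integral_bump L phi i (h dh : R -> R) K a s t b :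
  lipschitz2 L phi -> 0 <= K ->
  (forall x y, `|h y - h x - dh x * (y - x)| <= K * (y - x) ^+ 2) ->
  0 < a -> a < s -> s < t -> t < b -> b < 1 ->
  (forall u, a <= u <= s -> h (centered gamma i u) = 0 /\ dh (centered gamma i u) = 0) ->
  (forall u, t <= u <= b -> h (centered gamma i u) = 1 /\ dh (centered gamma i u) = 0) ->
  (forall u, 0 <= u <= a \/ b <= u <= 1 -> pullback gamma phi u = 0) ->
  (forall u, a <= u <= s \/ t <= u <= b -> pullback gamma phi u = 0) ->
  (forall u, s <= u <= t -> pullback gamma phi u = dh (centered gamma i u)) ->
  form_integral gamma phi i = 1.
Proof.
move=> [L0 Lphi] K0 taylor a0 as_ st tb b1 h0 h1 out flat mid.
have [A0 hA0] := holder_centered hgamma 0.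
have [A1 hA1] := holder_centered hgamma 1.
have hF : holder w al (L * (A0 + A1)) (pullback gamma phi).
  by apply: (holder_lipschitz L0 _ hA0 hA1) => u v _ _ _; exact: Lphi.
have [B hB] := hgamma i.
(* The expected primitive of the integrand along the curve. *)
pose H u := if u < a then 0 else if u <= b then h (centered gamma i u) else 1.
have Hmid u : a <= u -> u <= b -> H u = h (centered gamma i u).
  by move=> au ub; rewrite /H ltNge au /= ub.
have H0 u : u <= s -> H u = 0.
  move=> us; rewrite /H; case: ltP => // au; rewrite ifT; last by lra.
  by have [] := h0 u _; rewrite ?au.
have H1 u : t <= u -> H u = 1.
  move=> tu; rewrite /H ifF; last by apply/negbTE; rewrite -leNgt; lra.
  by case: leP => // ub; have [] := h1 u _; rewrite ?tu.
(* An interval shorter than [d] that starts before a ends before s, where H is 0; one that starts in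
   [a, t] ends before b, where H is h(z_i); after t, H is 1. *)
pose d := Num.min (s - a) (Num.min (t - s) (b - t)).
have d0 : 0 < d by rewrite !lt_min !subr_gt0 as_ st.
rewrite /form_integral (young_unique cw al2 hF hB (H := H) (M := K * (B * B)) (d := d))//.
- by rewrite H1 ?H0 ?subr0//; lra.
- by rewrite mulr_ge0// mulr_ge0// (proj1 hB).
move=> u v u0 uv v1; rewrite !lt_min => /andP[uva /andP[uvs uvt]].
have v0 : 0 <= v by exact: le_trans uv.
have u1 : u <= 1 by exact: le_trans v1.
have rhs0 : 0 <= K * (B * B) * w u v `^ (al + al).
  by rewrite !mulr_ge0 ?powR_ge0// (proj1 hB).
have tayloruv : `|h (centered gamma i v) - h (centered gamma i u)
    - dh (centered gamma i u) * (gamma v 0 i - gamma u 0 i)|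
    <= K * (B * B) * w u v `^ (al + al).
  have -> : gamma v 0 i - gamma u 0 i = centered gamma i v - centered gamma i u.
    by rewrite /centered; ring.
  rewrite (le_trans (taylor _ _))// -mulrA ler_wpM2l//.
  have -> : centered gamma i v - centered gamma i u = gamma v 0 i - gamma u 0 i.
    by rewrite /centered; ring.
  rewrite expr2 (le_trans (ler_norm _))//.
  exact: (holder_mul_le cw al2 hB hB).
have [ua|au] := ltP u a.
  have vs : v <= s by clear -ua uva; lra.
  rewrite out ?H0 ?(mul0r, subr0, normr0)//; last by left; rewrite u0 ltW.
  by rewrite (le_trans uv).
have [us|su] := leP u s.
  have vb : v <= b by clear -us uvs tb; lra.
  have ub := le_trans uv vb; have av := le_trans au uv.
  rewrite -!Hmid// in tayloruv.
  rewrite flat; last by left; rewrite au.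
  by have [_ e] := h0 u ltac:(by rewrite au); rewrite e in tayloruv.
have [ut|tu] := leP u t.
  have vb : v <= b by clear -ut uvt; lra.
  have ub := le_trans uv vb; have av := le_trans au uv.
  by rewrite mid ?(ltW su)// !Hmid.
have -> : pullback gamma phi u = 0.
  have [ub|bu] := leP u b; first by apply: flat; right; rewrite ltW.
  by apply: out; right; rewrite ltW.
have tu' := ltW tu; have tv := le_trans tu' uv.
by rewrite !H1 ?(mul0r, subrr, normr0).
Qed.

End OneCurve.

Lemma centered_eq gamma gamma' v v' :
  centered gamma 0 v = centered gamma' 0 v' ->
  centered gamma 1 v = centered gamma' 1 v' -> gamma v - gamma 0 = gamma' v' - gamma' 0.
Proof.
move=> e0 e1; apply/rowP => i; rewrite !mxE.
by case: (ord2P i) => ->.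
Qed.

Lemma ucont_centered gamma i : ucont (fun u => gamma u 0 i) -> ucont (centered gamma i).
Proof.
move=> ug e /ug[d d0 hd]; exists d => // s t s01 t01 /(hd _ _ s01 t01).
by rewrite /centered; congr (`|_| < _); ring.
Qed.

(** As u may be an endpoint of [0, 1], the interval lies on the side of u facing the middle; r <=
    1/2 keeps it inside. *)
Lemma small_arc u r : 0 <= u <= 1 -> 0 < r -> r <= 2^-1 ->
  exists s t, [/\ 0 < s, s < t, t < 1 &
    forall v, s <= v <= t -> 0 <= v <= 1 /\ `|u - v| < r].
Proof.
move=> /andP[u0 u1] r0 r2; have [uh|uh] := leP u 2^-1.
  exists (u + r / 3), (u + 2 * r / 3); split; try lra.
  by move=> v /andP[? ?]; rewrite ltr_norml; split; lra.
exists (u - 2 * r / 3), (u - r / 3); split; try lra.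
by move=> v /andP[? ?]; rewrite ltr_norml; split; lra.
Qed.

(** The point at u has positive distance m to the other trace; on a short enough interval near u
    each coordinate moves by less than m / 2. *)
Lemma arc_off_trace gamma gamma' u :
  (forall i, ucont (centered gamma i)) -> (forall i, ucont (centered gamma' i)) ->
  0 <= u <= 1 ->
  (forall v, 0 <= v <= 1 -> centered gamma 0 u = centered gamma' 0 v ->
    centered gamma 1 u <> centered gamma' 1 v) ->
  exists s t, [/\ 0 < s, s < t, t < 1 & forall v v', s <= v <= t -> 0 <= v' <= 1 ->
    centered gamma 0 v = centered gamma' 0 v' ->
    centered gamma 1 v <> centered gamma' 1 v'].
Proof.
move=> ucX ucX' u01 notin.
have [m m0 hm] : exists2 m, 0 < m & forall v, 0 <= v <= 1 ->
    m <= `|centered gamma 0 u - centered gamma' 0 v|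
       + `|centered gamma 1 u - centered gamma' 1 v|.
  exists (arc_dist (centered gamma' 0) (centered gamma' 1) 0 1
    (centered gamma 0 u) (centered gamma 1 u)); last first.
    by move=> v v01; exact: arc_dist_le.
  apply: (arc_dist_gt0 (ucX' 0) (ucX' 1)) => // v v01 e0 e1.
  exact: notin v01 (esym e0) (esym e1).
have m2 : 0 < m / 2 by rewrite divr_gt0.
have [r0 r00 hr0] := ucX 0 _ m2; have [r1 r10 hr1] := ucX 1 _ m2.
pose r := Num.min (Num.min r0 r1) (2^-1).
have rr0 : r <= r0 by rewrite !ge_min lexx.
have rr1 : r <= r1 by rewrite !ge_min lexx orbT.
have rh : r <= 2^-1 by rewrite !ge_min lexx orbT.
have rpos : 0 < r by rewrite !lt_min r00 r10 /= invr_gt0 ltr0n.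
have [s [t [s0 st t1 near]]] := small_arc u01 rpos rh.
exists s, t; split=> // v v' svt v'01 e0 e1; have [v01 vu] := near v svt.
have := hm v' v'01; rewrite -e0 -e1 leNgt => /negP; apply.
by rewrite [ltRHS]splitr ltrD ?hr0 ?hr1// (lt_le_trans vu).
Qed.

Lemma lipschitz2_cutoff chi k (p l : R) i : 0 <= k -> lipschitz2 k chi ->
  (forall x y, `|chi x y| <= 1) ->
  exists L, lipschitz2 L
    (fun x y => chi x y * (p * dsmoothstep (p * coord i x y + l))).
Proof.
move=> k0 chiL chi1; exists (k * (`|p| * 6) + 1 * (`|p| * (6 * `|p|))).
apply: lipschitz2M => //.
- split; first by rewrite !mulr_ge0.
  move=> x y x' y'; rewrite -mulrBr normrM -!mulrA ler_wpM2l//.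
  rewrite (le_trans (dsmoothstep_lipschitz _ _))// ler_wpM2l//.
  rewrite (_ : _ - _ = p * (coord i x' y' - coord i x y)); last by ring.
  rewrite normrM ler_wpM2l// /coord.
  by case: ifP => _; rewrite ?lerDl ?lerDr.
- by move=> x y; rewrite normrM ler_wpM2l// dsmoothstep_bound.
Qed.

(* The step z |-> smoothstep (p * z + l) goes from 0 to 1 between the first and
   the second third of the segment from c to c + D. *)
Lemma step_ends (c D z : R) : D != 0 -> let p := 3 / D in let l := - (p * c) - 1 in
  (`|z - c| < `|D| / 3 ->
    smoothstep (p * z + l) = 0 /\ p * dsmoothstep (p * z + l) = 0) /\
  (`|z - (c + D)| < `|D| / 3 ->
    smoothstep (p * z + l) = 1 /\ p * dsmoothstep (p * z + l) = 0).
Proof.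
move=> D0 p l.
have small x : `|x| < `|D| / 3 -> -1 < p * x < 1.
  rewrite -ltr_norml => hx; rewrite normrM normrM normfV [`|3|]ger0_norm//.
  by rewrite mulrAC ltr_pdivrMr ?normr_gt0// mul1r mulrC -ltr_pdivlMr.
split=> /small; rewrite /l => /andP[h1 h2].
  have [] := @smoothstep0 R (p * z + l); last by rewrite /l => -> ->; rewrite mulr0.
  by rewrite /l; lra.
have pD : p * D = 3 by rewrite /p divfK.
have [] := @smoothstep1 R (p * z + l); last by rewrite /l => -> ->; rewrite mulr0.
by rewrite /l; move: h1; rewrite mulrBr mulrDr pD; lra.
Qed.

Lemma smoothstep_affine_taylor (p l x y : R) :
  `|smoothstep (p * y + l) - smoothstep (p * x + l)
    - p * dsmoothstep (p * x + l) * (y - x)| <= 9 * p ^+ 2 * (y - x) ^+ 2.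
Proof.
have := smoothstep_taylor (p * x + l) (p * y + l).
rewrite (_ : p * y + l - (p * x + l) = p * (y - x)); last by ring.
by rewrite exprMn mulrA mulrA [dsmoothstep _ * p]mulrC.
Qed.

Lemma trace_sub w w' al gamma gamma' :
  control w -> control w' -> 1 < al + al ->
  (forall i, is_holder w al (fun u => gamma u 0 i)) ->
  (forall i, is_holder w' al (fun u => gamma' u 0 i)) ->
  (forall i, ucont (fun u => gamma u 0 i)) ->
  (forall i, ucont (fun u => gamma' u 0 i)) ->
  set_inj `[0, 1] gamma ->
  (forall L phi i, lipschitz2 L phi ->
    form_integral gamma phi i = form_integral gamma' phi i) ->
  forall u, 0 <= u <= 1 -> exists2 v, 0 <= v <= 1 &
    gamma u - gamma 0 = gamma' v - gamma' 0.
Proof.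
move=> cw cw' al2 hg hg' ug ug' inj same u u01; apply: contrapT => notin.
have ucX i : ucont (centered gamma i) by exact: ucont_centered.
have ucX' i : ucont (centered gamma' i) by exact: ucont_centered.
have injX v v' : 0 <= v <= 1 -> 0 <= v' <= 1 ->
    centered gamma 0 v = centered gamma 0 v' ->
    centered gamma 1 v = centered gamma 1 v' -> v = v'.
  move=> v01 v'01 e0 e1; apply: inj; rewrite ?inE /= ?in_itv//.
  by have /eqP := centered_eq e0 e1; rewrite subr_eq subrK => /eqP.
have [|s [t [s0 st t1 off]]] := arc_off_trace ucX ucX' u01.
  by move=> v v01 e0 e1; apply: notin; exists v => //; exact: centered_eq.
have st' := ltW st; have s0' := ltW s0; have t1' := ltW t1.
(* By injectivity the two ends of the arc differ in some coordinate; the step is built along it. *)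
have [i ci] : exists i, gamma s 0 i != gamma t 0 i.
  apply: ord2_neq; apply/eqP => e; move: st; rewrite (_ : s = t) ?ltxx//.
  apply: inj; rewrite ?inE //= in_itv /= ?s0' ?t1' ?(le_trans s0')//.
  by rewrite (le_trans st').
pose c := centered gamma i s; pose D := centered gamma i t - c.
have D0 : D != 0.
  by rewrite /D /c /centered opprB addrA subrK subr_eq0 eq_sym.
have D3 : 0 < `|D| / 3 by rewrite divr_gt0// normr_gt0.
have [q q0 hq] := ucX i _ D3.
(* On [a, s] and [t, b] the i-th coordinate stays within |D| / 3 of its value at the end of the arc,
   so the step is flat there whatever the cutoff does. *)
have [a [a0 sa aq]] : exists a, [/\ 0 < a, a < s & s - a < q].
  clear -s0 q0; exists (Num.max (s / 2) (s - q / 2)).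
  split; first by rewrite lt_max; lra.
    by rewrite gt_max; lra.
  by rewrite ltrBlDr -ltrBlDl lt_max; lra.
have [b [b1 tb bq]] : exists b, [/\ b < 1, t < b & b - t < q].
  clear -t1 q0; exists (Num.min ((1 + t) / 2) (t + q / 2)).
  split; first by rewrite gt_min; lra.
    by rewrite lt_min; lra.
  by rewrite ltrBlDl gt_min; lra.
have a1 : a <= 1 by rewrite (le_trans (ltW sa))// (le_trans st').
have b0 : 0 <= b by rewrite (le_trans _ (ltW tb))// (le_trans s0').
have v01P v : s <= v <= t -> 0 <= v <= 1.
  by move=> /andP[sv vt]; rewrite (le_trans s0')// (le_trans vt).
have dsep := arc_separated (ucX 0) (ucX 1) s0' st' t1'.
(* The cutoff scale lies below the distances from the arc to the curve on [0, a] and on [b, 1],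
   positive by injectivity, and to the other trace. The pieces on [a, s] and [t, b] touch the arc
   and are left out. *)
have [k1 k10 hk1] : exists2 k, 0 < k & forall v, 0 <= v <= a ->
    k <= arc_dist (centered gamma 0) (centered gamma 1) s t
      (centered gamma 0 v) (centered gamma 1 v).
  apply: (dsep _ _ 0 a (lexx 0) (ltW a0) a1 (ucX 0) (ucX 1)).
  move=> v v' /andP[v0 va] svt e0 e1.
  have v01 : 0 <= v <= 1 by rewrite v0 (le_trans va).
  have e := injX v' v (v01P _ svt) v01 e0 e1; move: svt; rewrite e => /andP[sv _].
  by move: sa; rewrite ltNge (le_trans sv va).
have [k2 k20 hk2] : exists2 k, 0 < k & forall v, b <= v <= 1 ->
    k <= arc_dist (centered gamma 0) (centered gamma 1) s t
      (centered gamma 0 v) (centered gamma 1 v).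
  apply: (dsep _ _ b 1 b0 (ltW b1) (lexx 1) (ucX 0) (ucX 1)).
  move=> v v' /andP[bv v1] svt e0 e1.
  have v01 : 0 <= v <= 1 by rewrite v1 (le_trans b0).
  have e := injX v' v (v01P _ svt) v01 e0 e1; move: svt; rewrite e => /andP[_ vt].
  by move: tb; rewrite ltNge (le_trans bv vt).
have [k3 k30 hk3] : exists2 k, 0 < k & forall v, 0 <= v <= 1 ->
    k <= arc_dist (centered gamma 0) (centered gamma 1) s t
      (centered gamma' 0 v) (centered gamma' 1 v).
  apply: (dsep _ _ 0 1 (lexx 0) ler01 (lexx 1) (ucX' 0) (ucX' 1)) => v v' v01 svt.
  exact: off.
pose k := Num.min k1 (Num.min k2 k3).
have k0 : 0 < k by rewrite !lt_min k10 k20.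
have kk1 : k <= k1 by rewrite !ge_min lexx.
have kk2 : k <= k2 by rewrite !ge_min lexx orbT.
have kk3 : k <= k3 by rewrite !ge_min lexx !orbT.
pose p := 3 / D; pose l := - (p * c) - 1.
pose chi := arc_bump (centered gamma 0) (centered gamma 1) s t k.
pose phi x y := chi x y * (p * dsmoothstep (p * coord i x y + l)).
have [L phiL] : exists L, lipschitz2 L phi.
  apply: (@lipschitz2_cutoff chi k^-1); first by rewrite invr_ge0 ltW.
    exact: arc_bump_lipschitz.
  by move=> x y; have /andP[h0 h1] := clamp_itv (1 - arc_dist (centered gamma 0)
    (centered gamma 1) s t x y / k); rewrite ger0_norm.
have phiE v : pullback gamma phi v = chi (centered gamma 0 v) (centered gamma 1 v)
    * (p * dsmoothstep (p * centered gamma i v + l)).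
  by rewrite /pullback /phi coordE.
have ends z := step_ends c z D0.
have cD : c + D = centered gamma i t by rewrite /D addrC subrK.
have left_end v : a <= v <= s -> smoothstep (p * centered gamma i v + l) = 0 /\
    p * dsmoothstep (p * centered gamma i v + l) = 0.
  move=> /andP[av vs]; apply: (ends _).1; apply: hq.
  - by rewrite (le_trans (ltW a0))//= (le_trans vs)// (le_trans st').
  - by rewrite s0' (le_trans st').
  - by rewrite distrC ger0_norm ?subr_ge0// (le_lt_trans _ aq)// lerB.
have right_end v : t <= v <= b -> smoothstep (p * centered gamma i v + l) = 1 /\
    p * dsmoothstep (p * centered gamma i v + l) = 0.
  move=> /andP[tv vb]; apply: (ends _).2; rewrite cD; apply: hq.
  - by rewrite (le_trans s0')//= ?(le_trans st')// (le_trans vb)// ltW.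
  - by rewrite t1' (le_trans s0').
  - by rewrite ger0_norm ?subr_ge0// (le_lt_trans _ bq)// lerB.
(* The contradiction is 1 = 0: the form integrates to 1 along gamma and vanishes on the other
   curve. *)
have := same _ phi i phiL.
rewrite (form_integral0 cw' al2 hg' i); last first.
  move=> v v01; rewrite /pullback /phi /chi arc_bump0 ?mul0r//.
  exact: le_trans kk3 (hk3 v v01).
rewrite (form_integral_bump cw al2 hg (h := fun z => smoothstep (p * z + l))
  (dh := fun z => p * dsmoothstep (p * z + l))
  (K := 9 * p ^+ 2) (a := a) (s := s) (t := t) (b := b) phiL)//.
- by move/eqP; rewrite oner_eq0.
- by rewrite mulr_ge0// sqr_ge0.
- by move=> x y; exact: smoothstep_affine_taylor.
- move=> v v01; rewrite phiE /chi arc_bump0 ?mul0r//.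
  by case: v01 => h; [exact: le_trans kk1 (hk1 v h)|exact: le_trans kk2 (hk2 v h)].
- by move=> v [/left_end|/right_end] [_ e]; rewrite phiE e mulr0.
- by move=> v svt; rewrite phiE /chi arc_bump1// mul1r.
Qed.

End Trace.

(** * Reparametrisations *)

Section Reparametrisation.
Variable R : realType.
Implicit Types (r : R -> R) (s t u v : R).

Lemma reparametrisation_itv r t : increasing_reparametrisation r ->
  0 <= t <= 1 -> 0 <= r t <= 1.
Proof.
by move=> [_ _ [rf _ _]] t01; have := rf t; rewrite /= !in_itv; exact.
Qed.

Lemma reparametrisation_le r s t : increasing_reparametrisation r ->
  0 <= s -> s <= t -> t <= 1 -> r s <= r t.
Proof.
move=> [_ rlt _] s0 st t1; move: (st); rewrite le_eqVlt => /predU1P[->//|st'].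
by apply/ltW/rlt; rewrite ?in_itv /= ?s0 ?t1 ?(le_trans st) ?(le_trans s0).
Qed.

Lemma reparametrisation_ends r : increasing_reparametrisation r -> r 0 = 0 /\ r 1 = 1.
Proof.
move=> hr; have [_ _ [_ _ rs]] := hr.
have /andP[a0 a1] := reparametrisation_itv hr (t := 0) ltac:(by rewrite lexx ler01).
have /andP[b0 b1] := reparametrisation_itv hr (t := 1) ltac:(by rewrite lexx ler01).
have [|u + e0] := rs 0; first by rewrite /= in_itv /= lexx ler01.
have [|v + e1] := rs 1; first by rewrite /= in_itv /= lexx ler01.
rewrite /= !in_itv /= => /andP[v0 v1] /andP[u0 u1].
have h0 := reparametrisation_le hr (lexx 0) u0 u1.
have h1 := reparametrisation_le hr v0 v1 (lexx 1).
by rewrite e0 in h0; rewrite e1 in h1; split; apply/le_anti/andP.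
Qed.

(** Monotonicity of r preserves superadditivity, and its uniform continuity preserves smallness on
    short intervals. *)
Lemma control_comp w r : control w -> increasing_reparametrisation r ->
  control (fun s t => w (r s) (r t)).
Proof.
move=> [w0 wD ws] hr.
have rle s t : 0 <= s -> s <= t -> t <= 1 -> r s <= r t by exact: reparametrisation_le.
have r0 s t : 0 <= s -> s <= t -> t <= 1 -> 0 <= r s /\ r t <= 1.
  move=> s0 st t1; have s01 : 0 <= s <= 1 by rewrite s0 (le_trans st).
  have t01 : 0 <= t <= 1 by rewrite t1 (le_trans s0).
  by have /andP[? _] := reparametrisation_itv hr s01;
    have /andP[_ ?] := reparametrisation_itv hr t01.
split.
- by move=> s t s0 st t1; have [? ?] := r0 s t s0 st t1; rewrite w0// rle.
- move=> s u t s0 su ut t1; have st := le_trans su ut.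
  have [? ?] := r0 s t s0 st t1.
  by rewrite wD// rle// ?(le_trans ut)// (le_trans s0).
- move=> e /ws[d d0 hd]; have [rc _ _] := hr.
  have [d' d'0 hd'] := heine rc d0; exists d' => // s t s0 st t1 ts.
  have [? ?] := r0 s t s0 st t1; apply: hd => //; first exact: rle.
  rewrite (le_lt_trans (ler_norm _))// hd' ?t1 ?s0 ?(le_trans s0) ?(le_trans st)//.
  by rewrite ger0_norm ?subr_ge0.
Qed.

Lemma holder_comp w r al F : increasing_reparametrisation r -> is_holder w al F ->
  is_holder (fun s t => w (r s) (r t)) al (F \o r).
Proof.
move=> hr [A [A0 hF]]; exists A; split=> // s t s0 st t1 /=.
apply: hF; last 1 first.
- have t01 : 0 <= t <= 1 by rewrite t1 (le_trans s0).
  by have /andP[] := reparametrisation_itv hr t01.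
- have s01 : 0 <= s <= 1 by rewrite s0 (le_trans st).
  by have /andP[] := reparametrisation_itv hr s01.
- exact: reparametrisation_le.
Qed.

(** Induction on the word: the integral along gamma, composed with r, has for the transported
    control the germ of the integral along the new curve, so [young_germ] identifies them. The
    translation disappears in the increments. *)
Lemma iterated_reparametrisation d (gamma gamma' : R -> 'rV[R]_d) c r w al :
  control w -> 1 < al + al -> (forall i, is_holder w al (fun u => gamma u 0 i)) ->
  increasing_reparametrisation r ->
  (forall t, 0 <= t <= 1 -> gamma' t = gamma (r t) + c) ->
  forall (v : seq 'I_d) t, 0 <= t <= 1 ->
    iterated_integral gamma' 0 v t = iterated_integral gamma 0 v (r t).
Proof.
move=> cw al2 hg hr gg'; pose w' s t := w (r s) (r t).
have cw' : control w' by exact: control_comp.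
have hg' i : is_holder w' al (fun u => gamma' u 0 i).
  apply: is_holder_eq (holderD (holder_comp hr (hg i)) (holder_cst w' al (c 0 i))).
  by move=> t t01; rewrite gg'// mxE.
elim/last_ind => [//|v i IH] t t01; rewrite iterated_integral_rcons.
rewrite (young_germ cw' al2 (holder_iterated v cw' al2 hg') (hg' i)
  (H := iterated_integral gamma 0 (rcons v i) \o r))//=.
  rewrite (reparametrisation_ends hr).1 iterated_integral_rcons.
  by rewrite (young_integral0 cw al2 (holder_iterated v cw al2 hg) (hg i)) subr0.
have [M hM] := germ_young cw al2 (holder_iterated v cw al2 hg) (hg i).
exists M => s u s0 su u1 /=; rewrite iterated_integral_rcons.
have s01 : 0 <= s <= 1 by rewrite s0 (le_trans su).
have u01 : 0 <= u <= 1 by rewrite u1 (le_trans s0).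
have -> : gamma' u 0 i - gamma' s 0 i = gamma (r u) 0 i - gamma (r s) 0 i.
  by rewrite !gg'// !mxE; ring.
rewrite IH//; apply: hM.
- by have /andP[] := reparametrisation_itv hr s01.
- exact: reparametrisation_le.
- by have /andP[] := reparametrisation_itv hr u01.
Qed.

Lemma signature_reparametrisation d (gamma gamma' : R -> 'rV[R]_d) c r w al :
  control w -> 1 < al + al -> (forall i, is_holder w al (fun u => gamma u 0 i)) ->
  increasing_reparametrisation r ->
  (forall t, 0 <= t <= 1 -> gamma' t = gamma (r t) + c) ->
  signature gamma 0 1 = signature gamma' 0 1.
Proof.
move=> cw al2 hg hr gg'; apply: functional_extensionality_dep => n.
apply/ffunP => v; rewrite !ffunE.
rewrite (iterated_reparametrisation cw al2 hg hr gg') ?ler01 ?lexx//.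
by rewrite (reparametrisation_ends hr).2.
Qed.

(* The inverse of a simple curve is continuous, by compactness of [0, 1]. *)
Lemma simple_modulus (gamma : R -> 'rV[R]_2) u e :
  (forall i, ucont (centered gamma i)) -> set_inj `[0, 1] gamma ->
  0 <= u <= 1 -> 0 < e -> exists2 m, 0 < m & forall v, 0 <= v <= 1 -> e <= `|u - v| ->
    m <= `|centered gamma 0 u - centered gamma 0 v|
       + `|centered gamma 1 u - centered gamma 1 v|.
Proof.
move=> ucX inj u01 e0.
have sep s t : 0 <= s -> t <= 1 -> (forall v, s <= v <= t -> v <> u) ->
    exists2 m, 0 < m & forall v, s <= v <= t ->
    m <= `|centered gamma 0 u - centered gamma 0 v|
       + `|centered gamma 1 u - centered gamma 1 v|.
  move=> s0 t1 neq; have [st|ts] := leP s t; last first.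
    (* The interval is empty when u is within e of an endpoint; any positive m then serves. *)
    by exists 1 => // v /andP[sv vt]; move: ts; rewrite ltNge (le_trans sv vt).
  exists (arc_dist (centered gamma 0) (centered gamma 1) s t
    (centered gamma 0 u) (centered gamma 1 u)); last first.
    by move=> v svt; exact: arc_dist_le.
  apply: (arc_dist_gt0 (ucX 0) (ucX 1)) => // v svt e0' e1'.
  apply: (neq v svt); apply: inj; rewrite ?inE /= ?in_itv //=.
    by case/andP: svt => sv vt; rewrite (le_trans s0 sv) (le_trans vt t1).
  by have /eqP := centered_eq e0' e1'; rewrite subr_eq subrK => /eqP.
have /andP[u0 u1] := u01.
have [||m1 m10 h1] := sep 0 (u - e) (lexx _); first by lra.
  by move=> v /andP[_ vu] vE; lra.
have [||m2 m20 h2] := sep (u + e) 1 _ (lexx _); first by lra.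
  by move=> v /andP[vu _] vE; lra.
exists (Num.min m1 m2); first by rewrite lt_min m10.
move=> v /andP[v0 v1]; rewrite ler_normr => /orP[h|h]; rewrite ge_min.
  by rewrite h1// v0; lra.
by rewrite h2 ?orbT// v1 andbT; lra.
Qed.

(** r is the inverse of gamma composed with the translated second curve: continuous by
    [simple_modulus], injective, and onto because the traces coincide in both directions. *)
Lemma same_trace_reparametrisation (gamma gamma' : R -> 'rV[R]_2) :
  (forall i, ucont (fun u => gamma u 0 i)) -> (forall i, ucont (fun u => gamma' u 0 i)) ->
  set_inj `[0, 1] gamma -> set_inj `[0, 1] gamma' ->
  (forall u, 0 <= u <= 1 -> exists2 v, 0 <= v <= 1 &
    gamma u - gamma 0 = gamma' v - gamma' 0) ->
  (forall u, 0 <= u <= 1 -> exists2 v, 0 <= v <= 1 &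
    gamma' u - gamma' 0 = gamma v - gamma 0) ->
  exists c r, increasing_reparametrisation r /\
    forall t, 0 <= t <= 1 -> gamma' t = gamma (r t) + c.
Proof.
move=> ug ug' inj inj' sub sub'.
have /choice[r hr] : forall u, exists v, 0 <= u <= 1 ->
    0 <= v <= 1 /\ gamma' u - gamma' 0 = gamma v - gamma 0.
  move=> u; have [/sub'[v v01 e]|] := boolP (0 <= u <= 1); first by exists v.
  by exists 0.
have r01 t (h : 0 <= t <= 1) := (hr t h).1.
have rE t (h : 0 <= t <= 1) := (hr t h).2.
have injE v v' : 0 <= v <= 1 -> 0 <= v' <= 1 ->
    gamma v - gamma 0 = gamma v' - gamma 0 -> v = v'.
  by move=> v01 v'01 /addIr; apply: inj; rewrite inE /= in_itv.
have rinj : {in `[0, 1]%R &, injective r}.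
  move=> s t; rewrite !in_itv /= => s01 t01 e.
  apply: inj'; rewrite ?inE /= ?in_itv//.
  by have := rE s s01; rewrite e -(rE t t01) => /addIr.
have rc : {within `[0, 1], continuous r}.
  apply/subspace_continuousP => u; rewrite /= in_itv /= => u01.
  apply/cvgrPdist_lt => e e0; rewrite near_withinE.
  have ucX i : ucont (centered gamma i) by exact: ucont_centered.
  have [m m0 hm] := simple_modulus ucX inj (r01 u u01) e0.
  have m2 : 0 < m / 2 by rewrite divr_gt0.
  have [d0 d00 h0] := ug' 0 _ m2; have [d1 d10 h1] := ug' 1 _ m2.
  exists (Num.min d0 d1); first by rewrite /= lt_min d00.
  move=> v /=; rewrite lt_min => /andP[uv0 uv1]; rewrite in_itv /= => v01.
  rewrite ltNge; apply/negP => ev; have := hm (r v) (r01 v v01) ev.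
  have E i : centered gamma i (r u) - centered gamma i (r v) = gamma' u 0 i - gamma' v 0 i.
    have := congr1 (fun x : 'rV[R]_2 => x 0 i) (rE u u01).
    have := congr1 (fun x : 'rV[R]_2 => x 0 i) (rE v v01).
    rewrite /= !mxE /centered => <- <-; ring.
  rewrite !E leNgt => /negP; apply.
  by rewrite [ltRHS]splitr ltrD ?h0 ?h1.
have z01 : 0 <= (0 : R) <= 1 by rewrite lexx ler01.
have o01 : 0 <= (1 : R) <= 1 by rewrite lexx ler01.
have r0 : r 0 = 0.
  by apply: injE => //; [exact: r01|rewrite -rE// !subrr].
(* A continuous injection of an interval is monotone; the common starting point gives r 0 = 0 <= r
   1, hence the increasing case. *)
have rmono : {in `[0, 1]%R &, {mono r : s t / s <= t}}.
  by apply: segment_continuous_inj_le => //; rewrite r0; case/andP: (r01 1 o01).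
exists (gamma' 0 - gamma 0), r; split; last first.
  by move=> t t01; rewrite addrCA -rE// addrC subrK.
split=> //; first by move=> s t s01 t01; rewrite (leW_mono_in rmono).
split.
- by move=> t /=; rewrite !in_itv; exact: r01.
- by move=> s t; rewrite !inE; exact: rinj.
- move=> v /=; rewrite in_itv /= => v01; have [u u01 e] := sub v v01.
  exists u; first by rewrite /= in_itv.
  by apply: injE; rewrite ?r01// -rE// e.
Qed.

End Reparametrisation.

(** * The equivalence for simple curves of finite p-variation *)

Theorem theorem3 (R : realType) (p : R) (gamma gamma' : R -> 'rV[R]_2)
    (p_ge1 : 1 <= p) (p_lt2 : p < 2)
    (gamma_simple : simple_curve gamma)
    (gamma'_simple : simple_curve gamma')
    (gamma_pvar : finite_pvariation p 0 1 gamma)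
    (gamma'_pvar : finite_pvariation p 0 1 gamma') :
  signature gamma 0 1 = signature gamma' 0 1 <->
  exists (c : 'rV[R]_2) (r : R -> R),
    increasing_reparametrisation r /\
    forall t : R, 0 <= t <= 1 -> gamma' t = gamma (r t) + c.
Proof.
have [gc ginj] := gamma_simple; have [gc' ginj'] := gamma'_simple.
(* q > p makes [qvar] a control, and q < 2 makes the exponent 2 / q exceed 1. *)
pose q := (p + 2) / 2; have pq : p < q by rewrite /q; lra.
have q2 : q < 2 by rewrite /q; lra.
have q0 : 0 < q by lra.
have al2 : 1 < q^-1 + q^-1.
  by rewrite -mulr2n -mulr_natl ltr_pdivlMr// mul1r.
have cw := control_qvar p_ge1 pq gc gamma_pvar.
have cw' := control_qvar p_ge1 pq gc' gamma'_pvar.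
have hg := holder_qvar p_ge1 pq gc gamma_pvar.
have hg' := holder_qvar p_ge1 pq gc' gamma'_pvar.
split=> [/signature_iterated same|[c [r [hr gg']]]]; last first.
  exact: signature_reparametrisation cw al2 hg hr gg'.
have ug i := ucont_coord i gc; have ug' i := ucont_coord i gc'.
(* [trace_sub] is used twice with the curves exchanged, once for each inclusion of traces. *)
apply: same_trace_reparametrisation => //.
  apply: (trace_sub cw cw' al2 hg hg') => // L phi i.
  exact: (form_integral_eq cw cw' al2 hg hg' same).
apply: (trace_sub cw' cw al2 hg' hg) => // L phi i.
exact: (form_integral_eq cw' cw al2 hg' hg (fun v => esym (same v))).
Qed.
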